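(* Fix a node $p$ with $N_p\ge 1$ neighbors, integers $d\ge1$, $B_p\ge1$, constants $C^R>0$, $\rho>0$, $\eta>0$, a privacy parameter $\alpha>0$, and fixed vectors $\lambda\in\mathbb{R}^d$, $f_p(t)\in\mathbb{R}^d$ and $f_i(t)\in\mathbb{R}^d$ for $i\in\mathcal{N}_p$ (these do not depend on the dataset). Given a dataset $D_p=((x_j,y_j))_{j=1}^{B_p}$, the dual variable perturbation step is: (i) set $\hat\alpha=\alpha-2\ln\!\Big(1+\frac{c_1C^R}{B_p(\rho+2\eta N_p)}\Big)$; if $\hat\alpha>0$ set $\Phi=0$; otherwise set $\Phi=\frac{c_1C^R}{B_p(e^{\alpha/4}-1)}-\rho-2\eta N_p$ and redefine $\hat\alpha=\alpha/2$; (ii) draw $\epsilon\in\mathbb{R}^d$ with density proportional to $e^{-(\hat\alpha/2)\|\epsilon\|}$ and set $\mu=\lambda+\frac{C^R}{2B_p}\epsilon$; (iii) output $$f_p(t+1)=\arg\min_{f\in\mathbb{R}^d}\ \frac{C^R}{B_p}\sum_{j=1}^{B_p}\mathcal{L}(y_jf^Tx_j)+\rho R(f)+2\mu^Tf+\frac{\Phi}{2}\|f\|^2+\eta\sum_{i\in\mathcal{N}_p}\Big\|f-\tfrac12\big(f_p(t)+f_i(t)\big)\Big\|^2 .$$ Then for any two neighboring datasets $D_p,D_p'$, the output $f_p(t+1)$ has a density under each, denoted $Q(\cdot\mid D_p)$ and $Q(\cdot\mid D_p')$, and for every $f\in\mathbb{R}^d$, $$\frac{Q(f\mid D_p)}{Q(f\mid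 D_p')}\le e^{\alpha}.$$
   Context: Data points satisfy $x_j\in\mathbb{R}^d$ with $\|x_j\|\le 1$ (Euclidean norm) and $y_j\in\{-1,1\}$. The loss $\mathcal{L}:\mathbb{R}\to\mathbb{R}$ is strictly convex and twice continuously differentiable with $|\mathcal{L}'|\le 1$ and $|\mathcal{L}''|\le c_1$ for a constant $c_1>0$. The regularizer $R:\mathbb{R}^d\to\mathbb{R}$ is twice continuously differentiable and 1-strongly convex. Two datasets of the same size $B_p$ are neighboring if they differ in exactly one data point. $\|\cdot\|$ is the Euclidean norm. *)

(* Defs.v *)
From HB Require Import structures.
From mathcomp Require Import all_boot all_order all_algebra.
From mathcomp Require Import all_classical all_reals all_analysis.
Set Implicit Arguments. Unset Strict Implicit. Unset Printing Implicit Defensive.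
Import Order.TTheory GRing.Theory Num.Theory.
Import numFieldNormedType.Exports.
Local Open Scope classical_set_scope.
Local Open Scope ring_scope.

Definition rV_display : measure_display -> measure_display.
Proof. exact. Qed.

Section measurable_rV.
Context {R : realType} (n : nat).
Let coors : 'I_n -> 'rV[R]_n -> R := fun i x => x ord0 i.
Let rV_set0 : g_sigma_preimage coors set0.
Proof. exact: sigma_algebra0. Qed.
Let rV_setC A : g_sigma_preimage coors A -> g_sigma_preimage coors (~` A).
Proof. exact: sigma_algebraC. Qed.
Let rV_bigcup (F : _^nat) : (forall i, g_sigma_preimage coors (F i)) ->
  g_sigma_preimage coors (\bigcup_i (F i)).
Proof. exact: sigma_algebra_bigcup. Qed.
HB.instance Definition _ := @isMeasurable.Build (rV_display default_measure_display)
  'rV[R]_n (g_sigma_preimage coors) rV_set0 rV_setC rV_bigcup.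
End measurable_rV.

Section defs.
Context {R : realType}.

Definition enorm (d : nat) (v : 'rV[R]_d) : R := Num.sqrt (\sum_(i < d) v ord0 i ^+ 2).
Definition dotp (d : nat) (u v : 'rV[R]_d) : R := \sum_(i < d) u ord0 i * v ord0 i.

(* Lebesgue measure on R^d : the measure giving every box its volume
   (it exists and is unique on the product sigma-algebra). *)
Definition is_lebesgue_rV (d : nat) (Leb : {measure set 'rV[R]_d -> \bar R}) : Prop :=
  forall a b : 'rV[R]_d, (forall i, a ord0 i <= b ord0 i) ->
    Leb [set x | forall i, a ord0 i < x ord0 i <= b ord0 i]
    = (\prod_(i < d) (b ord0 i - a ord0 i))%:E.

Definition strictly_convex (L : R -> R) : Prop :=
  forall x y t : R, x != y -> 0 < t < 1 ->
    L (t * x + (1 - t) * y) < t * L x + (1 - t) * L y.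

Definition C2_real (L : R -> R) : Prop :=
  (forall x, derivable L x 1) /\ (forall x, derivable (derive1 L) x 1) /\
  continuous (derive1 (derive1 L)).

Definition ebasis (d : nat) (i : 'I_d) : 'rV[R]_d := delta_mx ord0 i.

Definition C2_rV (d : nat) (g : 'rV[R]_d -> R) : Prop :=
  (forall i x, derivable g x (ebasis i)) /\
  (forall i, continuous (fun x => 'D_(ebasis i) g x)) /\
  (forall i j x, derivable (fun y => 'D_(ebasis i) g y) x (ebasis j)) /\
  (forall i j, continuous (fun x => 'D_(ebasis j) (fun y => 'D_(ebasis i) g y) x)).

Definition strongly_convex1 (d : nat) (g : 'rV[R]_d -> R) : Prop :=
  forall (x y : 'rV[R]_d) (t : R), 0 <= t <= 1 ->
    g (t *: x + (1 - t) *: y) <=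
      t * g x + (1 - t) * g y - 2^-1 * t * (1 - t) * enorm (x - y) ^+ 2.

(* argmin (the minimizer if one exists; unique here by strict convexity) *)
Definition argmin (d : nat) (J : 'rV[R]_d -> R) : 'rV[R]_d :=
  xget 0 [set f | forall g, J f <= J g].

Definition alpha_hat0 (c1 CR rho eta alpha : R) (Bp Np : nat) : R :=
  alpha - 2 * ln (1 + c1 * CR / (Bp%:R * (rho + 2 * eta * Np%:R))).

Definition Phi_param (c1 CR rho eta alpha : R) (Bp Np : nat) : R :=
  if 0 < alpha_hat0 c1 CR rho eta alpha Bp Np then 0
  else c1 * CR / (Bp%:R * (expR (alpha / 4) - 1)) - rho - 2 * eta * Np%:R.

Definition alpha_hat (c1 CR rho eta alpha : R) (Bp Np : nat) : R :=
  if 0 < alpha_hat0 c1 CR rho eta alpha Bp Np then alpha_hat0 c1 CR rho eta alpha Bp Np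
  else alpha / 2.

Definition objective (d Bp Np : nat) (Loss : R -> R) (Reg : 'rV[R]_d -> R)
  (c1 CR rho eta alpha : R) (lam fp : 'rV[R]_d) (fN : 'I_Np -> 'rV[R]_d)
  (X : 'I_Bp -> 'rV[R]_d) (Y : 'I_Bp -> R) (eps : 'rV[R]_d) (f : 'rV[R]_d) : R :=
  let mu := lam + (CR / (2 * Bp%:R)) *: eps in
  CR / Bp%:R * (\sum_(j < Bp) Loss (Y j * dotp f (X j)))
  + rho * Reg f + 2 * dotp mu f
  + Phi_param c1 CR rho eta alpha Bp Np / 2 * enorm f ^+ 2
  + eta * \sum_(i < Np) enorm (f - 2^-1 *: (fp + fN i)) ^+ 2.

Definition output (d Bp Np : nat) (Loss : R -> R) (Reg : 'rV[R]_d -> R)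
  (c1 CR rho eta alpha : R) (lam fp : 'rV[R]_d) (fN : 'I_Np -> 'rV[R]_d)
  (X : 'I_Bp -> 'rV[R]_d) (Y : 'I_Bp -> R) (eps : 'rV[R]_d) : 'rV[R]_d :=
  argmin (objective Loss Reg c1 CR rho eta alpha lam fp fN X Y eps).

Definition noise_density (d : nat) (Leb : {measure set 'rV[R]_d -> \bar R}) (a : R)
  (e : 'rV[R]_d) : R :=
  expR (- (a / 2) * enorm e) /
    fine (\int[Leb]_(z in [set: 'rV[R]_d]) (expR (- (a / 2) * enorm z))%:E).

Definition output_law (d Bp Np : nat) (Leb : {measure set 'rV[R]_d -> \bar R})
  (Loss : R -> R) (Reg : 'rV[R]_d -> R)
  (c1 CR rho eta alpha : R) (lam fp : 'rV[R]_d) (fN : 'I_Np -> 'rV[R]_d)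
  (X : 'I_Bp -> 'rV[R]_d) (Y : 'I_Bp -> R) (A : set 'rV[R]_d) : \bar R :=
  \int[Leb]_(e in (output Loss Reg c1 CR rho eta alpha lam fp fN X Y) @^-1` A)
     (noise_density Leb (alpha_hat c1 CR rho eta alpha Bp Np) e)%:E.

Definition is_density (d : nat) (Leb : {measure set 'rV[R]_d -> \bar R})
  (Q : set 'rV[R]_d -> \bar R) (q : 'rV[R]_d -> R) : Prop :=
  (forall f, 0 <= q f) /\ measurable_fun [set: 'rV[R]_d] q /\
  (forall A : set 'rV[R]_d, measurable A -> (Q A = \int[Leb]_(f in A) (q f)%:E)%E).

Definition neighboring (d Bp : nat) (X : 'I_Bp -> 'rV[R]_d) (Y : 'I_Bp -> R)
  (X' : 'I_Bp -> 'rV[R]_d) (Y' : 'I_Bp -> R) : Prop :=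
  exists k : 'I_Bp, (X k, Y k) <> (X' k, Y' k) /\
    forall j, j != k -> (X j, Y j) = (X' j, Y' j).

Definition valid_data (d Bp : nat) (X : 'I_Bp -> 'rV[R]_d) (Y : 'I_Bp -> R) : Prop :=
  forall j, enorm (X j) <= 1 /\ (Y j = 1 \/ Y j = -1).

End defs.

(* Main.v *)
(* Let F, F0, F' map the noise to the minimizer of the objective for D_p, for D_p
   without the exchanged point, and for D'_p.  The first-order condition turns a
   change of the loss at a point x into a shift of the noise along x:
   F = F0 o U and F0 = F' o U' with U e = e + l'(F e . x) x and
   U' e = e - l'(F0 e . x') x'.  Strong convexity makes F and F0 antitone and
   Lipschitz, so on every line parallel to x the map U contracts distances at most
   by the factor K = 1 + c1 C^R / (B_p (rho + Phi + 2 eta N_p)), and U' expands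
   distances along x'.  A map that moves points only along x can be handled by
   averaging over translations along x (Tonelli) and a one-dimensional covering
   argument: the preimage of A under U' o U has measure at most K times that of A.
   With |U' (U e) - e| <= 2 this bounds the law under D_p by
   e^hat-alpha K <= e^alpha times the law under D'_p, with no change of variables.
   The laws have densities by Radon-Nikodym: the noise that leads to the minimizer
   f is a locally Lipschitz function of f because R is C^2, and such functions
   preserve null sets (comparison of measures on dyadic cubes). *)

(* The usual argument compares Jacobian determinants of the maps from the output to the noise. Here
   two shears, each reducible to one dimension, replace the determinants. Since 2 mu . f contains 2
   (C^R / (2 B_p)) e . f, the noise enters the objective with the weight c = C^R / B_p, which is
   also the weight of one loss term; so a loss term trades exactly for a noise shift l' x of norm at
   most 1. Two such shifts change the density proportional to exp(-(a/2) |e|) by a factor of at most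
   e^a. Volume costs K only once, because removing a point is free: the gradient of a convex loss at
   an antitone minimizer moves the noise outwards. The two branches of the algorithm are what make
   e^a K at most e^alpha: in the first, K = e^((alpha - a)/2); in the second, [Phi] is tuned so that
   K = e^(alpha/4), while a = alpha/2. Finally, comparing laws controls densities only almost
   everywhere, whereas the claim is for every f; the density under D_p is therefore truncated at
   e^alpha times the other one, which does not change its law. *)
Require Import Defs.
From HB Require Import structures.
From mathcomp Require Import all_boot all_order all_algebra.
From mathcomp Require Import all_classical all_reals all_analysis.
From mathcomp Require Import measurable_realfun.
From mathcomp Require Import ring lra.
Import Order.TTheory GRing.Theory Num.Theory.
Import numFieldNormedType.Exports.
Local Open Scope classical_set_scope.
Local Open Scope ring_scope.

(** * Measurability in R^d *)

Section rV_measurable.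
Context {R : realType} {d : nat}.

Lemma measurable_coord (i : 'I_d) :
  measurable_fun [set: 'rV[R]_d] (fun x => x ord0 i).
Proof.
move=> _ Y mY; rewrite setTI; apply: sub_sigma_algebra => /=.
rewrite -bigcup_seq/=; exists i => /=; first by rewrite mem_index_enum.
by exists Y => //; rewrite setTI.
Qed.

(** The induction principle for the product sigma-algebra: the real sets whose preimage under a
    coordinate lies in [S] form a sigma-algebra, and rays generate the Borel sets. *)
Lemma rV_measurable_sub (S : set (set 'rV[R]_d)) : sigma_algebra setT S ->
  (forall i a, S [set x | a < x ord0 i]) -> measurable `<=` S.
Proof.
move=> sS Sray; apply: smallest_sub => // A.
rewrite -bigcup_seq => -[i _ [Y mY <-]].
have : image_set_system setT (fun x : 'rV[R]_d => x ord0 i) S Y; last by [].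
have : <<s @RGenOInfty.G R >> Y by rewrite -[X in X Y]RGenOInfty.measurableE.
apply.
split; first exact: sigma_algebra_image.
move=> _ [a ->]; rewrite /image_set_system /= setTI.
have -> : (fun x : 'rV[R]_d => x ord0 i) @^-1` `]a, +oo[%classic =
    [set x | a < x ord0 i]; last exact: Sray.
by apply/seteqP; split => x /=; rewrite in_itv/= andbT.
Qed.

Lemma measurable_fun_rVP {d'} {T : measurableType d'} (f : T -> 'rV[R]_d) :
  (forall i, measurable_fun setT (fun t => f t ord0 i)) -> measurable_fun setT f.
Proof.
move=> mf _ A mA; rewrite setTI.
have : image_set_system setT f measurable A; last by rewrite /image_set_system /= setTI.
apply: rV_measurable_sub A mA.
  by apply: sigma_algebra_image; exact: sigma_algebra_measurable.
move=> i a; rewrite /image_set_system /=.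
have := mf i measurableT `]a, +oo[%classic (measurable_itv _).
by congr (measurable (_ `&` _)); apply/seteqP; split => x /=; rewrite in_itv/= andbT.
Qed.

Definition box (a b : 'rV[R]_d) : set 'rV[R]_d :=
  [set x | forall i, a ord0 i < x ord0 i <= b ord0 i].

Lemma measurable_box a b : measurable (box a b).
Proof.
rewrite (_ : box a b = \bigcap_(i in [set: 'I_d])
    ((fun x : 'rV[R]_d => x ord0 i) @^-1` `]a ord0 i, b ord0 i]%classic)).
  apply: fin_bigcap_measurable => // i _.
  by rewrite -[X in measurable X]setTI; exact: measurable_coord.
by apply/seteqP; split => [x ab i _|x ab i] /=; have := ab i; rewrite /= in_itv/=; [|apply].
Qed.

Lemma boxI a b a' b' : box a b `&` box a' b' =
  box (\row_i Num.max (a ord0 i) (a' ord0 i)) (\row_i Num.min (b ord0 i) (b' ord0 i)).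
Proof.
apply/seteqP; split => [x [ab ab'] i|x ab].
  by have := ab' i; have := ab i; rewrite !mxE gt_max le_min => /andP[-> ->] /andP[-> ->].
by split=> i; have := ab i; rewrite !mxE gt_max le_min => /andP[/andP[? ?] /andP[? ?]]; apply/andP.
Qed.

Definition cube (r : R) : set 'rV[R]_d := box (const_mx (- r)) (const_mx r).

Lemma cubeP (r : R) x : cube r x <-> forall i, - r < x ord0 i <= r.
Proof. by split => h i; have := h i; rewrite !mxE. Qed.

Lemma rV_bounded (x : 'rV[R]_d) : exists n : nat, forall i, `|x ord0 i| < n%:R.
Proof.
exists (\max_(i < d) (Num.truncn `|x ord0 i|).+1)%N => i.
rewrite (lt_le_trans (truncnS_gt _))// ler_nat.
by rewrite (bigD1 i)//= leq_maxl.
Qed.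

Lemma bigcup_cube : \bigcup_n cube n%:R = setT.
Proof.
rewrite -subTset => x _; have [n nx] := rV_bounded x.
by exists n => //; apply/cubeP => i; have := nx i; rewrite ltr_norml => /andP[-> /ltW].
Qed.

(** Boxes are stable under intersection, so with this generation result a measure is determined by
    its values on them. *)
Lemma rV_measurableE : @measurable _ 'rV[R]_d = <<s [set box p.1 p.2 | p in setT] >>.
Proof.
apply/seteqP; split; last first.
  apply: smallest_sub; first exact: sigma_algebra_measurable.
  by move=> _ [[a b] _ <-]; exact: measurable_box.
apply: rV_measurable_sub; first exact: smallest_sigma_algebra.
move=> i a; set G := (X in <<s X >>).
rewrite [X in _ X](_ : _ = \bigcup_n
    box (\row_j if j == i then a else - n%:R) (const_mx n%:R)); last first.
  apply/seteqP; split => x /=.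
    move=> ax; have [n nx] := rV_bounded x; exists n => // j; rewrite !mxE.
    have := nx j; rewrite ltr_norml => /andP[h1 /ltW ->]; rewrite andbT.
    by case: ifP => // /eqP ->.
  by move=> [n _ /(_ i)]; rewrite !mxE eqxx => /andP[].
by apply: sigma_algebra_bigcup => n; apply: sub_sigma_algebra;
  exists (\row_j if j == i then a else - n%:R, const_mx n%:R).
Qed.

Lemma measurable_rV_add (v : 'rV[R]_d) : measurable_fun setT (fun x : 'rV[R]_d => x + v).
Proof.
apply: measurable_fun_rVP => i; under eq_fun do rewrite mxE.
by apply: measurable_funD => //; exact: measurable_coord.
Qed.

Lemma measurable_enorm : measurable_fun setT (@enorm R d).
Proof.
apply: (@measurableT_comp _ _ _ _ _ _ (@Num.sqrt R)).
  by apply: continuous_measurable_fun; exact: sqrt_continuous.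
by apply: measurable_sum => i; apply: measurable_funX; exact: measurable_coord.
Qed.

End rV_measurable.

(** * Lebesgue measure and maps that move points along one direction *)

Section expanding_real.
Context {R : realType}.
Local Notation lam := (@lebesgue_measure R).
Local Open Scope ereal_scope.

Lemma lebesgue_measure_diam (E : set R) (D : R) : measurable E -> (0 <= D)%R ->
  (forall s s', E s -> E s' -> (s - s' <= D)%R) -> lam E <= D%:E.
Proof.
move=> mE D0 ED; have [->|/set0P E0] := eqVneq E set0.
  by rewrite measure0 lee_fin.
have [s0 Es0] := E0.
have uE : has_ubound E by exists (s0 + D)%R => s Es; rewrite -lerBlDl ED.
have lE : has_lbound E by exists (s0 - D)%R => s Es; rewrite lerBlDl -lerBlDr ED.
apply: (@le_trans _ _ (lam `[inf E, sup E]%classic)).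
  rewrite le_measure ?inE//= => s Es.
  by rewrite /= in_itv/= ge_inf//= ub_le_sup.
rewrite lebesgue_measure_itv/=; case: ifPn => _; last by rewrite lee_fin.
rewrite -EFinB lee_fin lerBlDr -lerBlDl lb_le_inf// => s Es.
rewrite lerBlDr; apply: ge_sup => // s' Es'.
by rewrite -lerBlDl ED.
Qed.

(** The covering argument: if [k] shrinks distances at most by the factor [K], the preimage of an
    interval of length b - a has diameter at most K (b - a). Neither monotonicity nor
    differentiability of [k] enters. *)
Lemma lebesgue_measure_expanding (k : R -> R) (K : R) (B : set R) : (0 < K)%R ->
  measurable_fun setT k ->
  (forall s s', `|s - s'| <= K * `|k s - k s'|)%R -> measurable B ->
  lam (k @^-1` B) <= K%:E * lam B.
Proof.
move=> K0 mk kK mB.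
have mkB Y : measurable Y -> measurable (k @^-1` Y).
  by move=> mY; rewrite -[X in measurable X]setTI; exact: mk.
(* After division by [K] the goal bounds from below the infimum that defines [lam B], so a single
   cover [M] of [B] by half-open intervals is considered. *)
rewrite muleC -lee_pdivrMr//.
apply: le_ereal_inf_tmp => _ [M [mM BM] <-].
rewrite lee_pdivrMr//.
apply: (@le_trans _ _ (\sum_(j <oo) lam (k @^-1` M j))).
  apply: measure_sigma_subadditive => //.
  - by move=> n; apply: mkB; apply: sub_sigma_algebra; exact: mM.
  - exact: mkB.
  - by rewrite -preimage_bigcup; exact: preimage_subset.
rewrite muleC -nneseriesZl; last by move=> n _; exact: measure_ge0.
apply: lee_nneseries => // n _.
have /ocitvP[->|[[a b] /= ab ->]] := mM n.
  by rewrite preimage_set0 measure0 measure0 mule0.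
rewrite wlength_itv /= lte_fin ab -EFinB -EFinM.
apply: lebesgue_measure_diam.
- by apply: mkB.
- by rewrite mulr_ge0 ?subr_ge0// ltW.
- move=> s s' /=; rewrite !in_itv/= => /andP[h1 h2] /andP[h3 h4].
  rewrite (le_trans (ler_norm _))// (le_trans (kK _ _))// ler_pM2l//.
  by rewrite ler_norml; apply/andP; split; lra.
Qed.

End expanding_real.

Section lebesgue_rV.
Context {R : realType} {d : nat} (Leb : {measure set 'rV[R]_d -> \bar R}).
Hypothesis hL : is_lebesgue_rV Leb.
Local Notation lam := (@lebesgue_measure R).
Local Open Scope ereal_scope.

Lemma lebesgue_box_lty (a b : 'rV[R]_d) : Leb (box a b) < +oo.
Proof.
have [ab|] := pselect (forall i, (a ord0 i <= b ord0 i)%R).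
  by rewrite (hL _ _ ab) ltry.
move=> /existsNP[i /negP]; rewrite -ltNge => ba.
rewrite (_ : box a b = set0) ?measure0//.
apply/seteqP; split => x //= /(_ i) /andP[ax xb].
by have := lt_le_trans ax xb; rewrite ltNge (ltW ba).
Qed.

Lemma lebesgue_rV_unique (mu : {measure set 'rV[R]_d -> \bar R}) :
  is_lebesgue_rV mu -> forall A, measurable A -> mu A = Leb A.
Proof.
move=> hmu A mA; apply/esym.
apply: (measure_unique [set box p.1 p.2 | p in [set: 'rV[R]_d * 'rV[R]_d]]
   (fun n => cube n%:R)) => //.
- exact: rV_measurableE.
- by move=> _ _ [[a b] _ <-] [[a' b'] _ <-]; rewrite boxI; eexists (_, _).
- by move=> n; eexists (_, _).
- exact: bigcup_cube.
- move=> _ [[a b] _ <-] /=.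
  have [ab|] := pselect (forall i, (a ord0 i <= b ord0 i)%R).
    by rewrite (hL _ _ ab) (hmu _ _ ab).
  move=> /existsNP[i /negP]; rewrite -ltNge => ba.
  rewrite (_ : box a b = set0) ?measure0//.
  apply/seteqP; split => x //= /(_ i) /andP[ax xb].
  by have := lt_le_trans ax xb; rewrite ltNge (ltW ba).
- by move=> n; exact: lebesgue_box_lty.
Qed.

(** The pushforward by a translation gives every box its volume, so uniqueness applies. *)
Lemma lebesgue_rV_translation (v : 'rV[R]_d) (A : set 'rV[R]_d) : measurable A ->
  Leb ((fun x => x + v)%R @^-1` A) = Leb A.
Proof.
move=> mA.
pose mv : {mfun 'rV[R]_d >-> 'rV[R]_d} :=
  HB.pack (fun x : 'rV[R]_d => (x + v)%R) (isMeasurableFun.Build _ _ _ _ _ (measurable_rV_add v)).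
apply: (@lebesgue_rV_unique (pushforward Leb mv)) => // a b ab.
rewrite /= /pushforward [X in Leb X](_ : _ = box (a - v)%R (b - v)%R); last first.
  apply/seteqP; split => x h i; have := h i; rewrite !mxE /= ?mxE.
    by rewrite ltrBlDr lerBrDr.
  by rewrite ltrBlDr lerBrDr.
rewrite hL; last by move=> i; rewrite !mxE lerB.
by congr (_%:E); apply: eq_bigr => i _; rewrite !mxE; ring.
Qed.

Lemma lebesgue_rV_sigma_finite : sigma_finite setT Leb.
Proof.
exists (fun n => cube n%:R); first by rewrite bigcup_cube.
by move=> n; split; [exact: measurable_box|exact: lebesgue_box_lty].
Qed.

(** [Leb] itself, bundled with the sigma-finiteness that the theorems of Tonelli and Radon-Nikodym
    ask for. *)
Definition lebesgue_rV_sf : {sigma_finite_measure set 'rV[R]_d -> \bar R} :=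
  HB.pack_for (SigmaFiniteMeasure.type 'rV[R]_d R) (Measure.sort Leb)
   (@isSFinite.Build _ _ _ (Measure.sort Leb)
      (sfinite_measure_sigma_finite lebesgue_rV_sigma_finite))
   (@isSigmaFinite.Build _ _ _ (Measure.sort Leb) lebesgue_rV_sigma_finite).

Lemma measurable_line (u : 'rV[R]_d) :
  measurable_fun setT (fun p : 'rV[R]_d * R => p.1 + p.2 *: u)%R.
Proof.
apply: measurable_fun_rVP => i; under eq_fun do rewrite !mxE.
apply: measurable_funD.
  by apply: (measurableT_comp (measurable_coord i)).
by apply: measurable_funM.
Qed.

(** The set to which Tonelli is applied: its sections at fixed s are translates of [A], those at
    fixed e are traces of [A] on lines parallel to [u]. *)
Let line_graph (u : 'rV[R]_d) (I : set R) (A : set 'rV[R]_d) :=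
  [set p : 'rV[R]_d * R | I p.2 /\ A (p.1 + p.2 *: u)%R].

Let measurable_line_graph u I A :
  measurable I -> measurable A -> measurable (line_graph u I A).
Proof.
move=> mI mA; apply: measurableI.
  by rewrite -[X in measurable X]setTI; exact: measurable_snd.
by rewrite -[X in measurable X]setTI; exact: measurable_line.
Qed.

Let xsection_line_graph u I A e :
  xsection (line_graph u I A) e = I `&` [set s | A (e + s *: u)%R].
Proof. by apply/seteqP; split => s; rewrite /xsection /= inE. Qed.

Let measurable_line_measure u I A : measurable I -> measurable A ->
  measurable_fun setT (fun e : 'rV[R]_d => lam (I `&` [set s | A (e + s *: u)%R])).
Proof.
move=> mI mA.
rewrite (_ : (fun _ => _) = lam \o xsection (line_graph u I A)); last first.
  by apply/funext => e /=; rewrite xsection_line_graph.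
by apply: measurable_fun_xsection; exact: measurable_line_graph.
Qed.

(** Every translate of [A] along [u] has measure [Leb A]; integrating over the translation parameter
    in [I] and exchanging the integrals expresses [Leb A] through one-dimensional traces. *)
Lemma lebesgue_rV_average (u : 'rV[R]_d) (I : set R) (A : set 'rV[R]_d) :
  measurable I -> measurable A ->
  Leb A * lam I = \int[Leb]_e lam (I `&` [set s | A (e + s *: u)%R]).
Proof.
move=> mI mA; set B := line_graph u I A.
have mB : measurable B by exact: measurable_line_graph.
have := @indic_fubini_tonelli _ _ 'rV[R]_d (measurableTypeR R) R lebesgue_rV_sf lam B mB.
rewrite indic_fubini_tonelli_FE// indic_fubini_tonelli_GE//= => h.
transitivity (\int[lam]_s Leb (ysection B s)); last first.
  by rewrite -h; apply: eq_integral => e _ /=; rewrite xsection_line_graph.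
rewrite muleC -[LHS]muleC -integral_cst// integral_mkcond.
apply: eq_integral => s _; rewrite patchE.
case: ifPn => [/set_mem Is|/negP Is].
  rewrite -(@lebesgue_rV_translation (s *: u)%R)//; congr (Leb _).
  by apply/seteqP; split => e; rewrite /ysection /= inE /B/= => // -[].
rewrite (_ : ysection B s = set0) ?measure0//.
by apply/seteqP; split => e //; rewrite /ysection /= inE /B/= => -[/mem_set].
Qed.

(** On each line parallel to [u] the shear acts as s + g (e + s u), to which the one-dimensional
    bound applies. Averaging over a window [-n, n] costs a boundary error controlled by [C], which
    is negligible as n grows. *)
Lemma lebesgue_rV_shear (u : 'rV[R]_d) (g : 'rV[R]_d -> R) (K C : R) (A : set 'rV[R]_d) :
  (0 < K)%R -> measurable_fun setT g -> (forall e, `|g e| <= C)%R ->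
  (forall e s s',
    `|s - s'| <= K * `|(s + g (e + s *: u)) - (s' + g (e + s' *: u))|)%R ->
  measurable A -> Leb ((fun e => e + g e *: u)%R @^-1` A) <= K%:E * Leb A.
Proof.
move=> K0 mg gC gK mA.
have C0 : (0 <= C)%R by exact: le_trans (gC 0%R).
have mU : measurable_fun setT (fun e : 'rV[R]_d => e + g e *: u)%R.
  apply: measurable_fun_rVP => i; under eq_fun do rewrite !mxE.
  by apply: measurable_funD; [exact: measurable_coord|exact: measurable_funM].
have mUA : measurable ((fun e => e + g e *: u)%R @^-1` A).
  by rewrite -[X in measurable X]setTI; exact: mU.
have mline e : measurable_fun setT (fun s : R => e + s *: u)%R.
  apply: measurable_fun_rVP => i; under eq_fun do rewrite !mxE.
  by apply: measurable_funD => //; exact: measurable_funM.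
(* The factors are the lengths of [-n, n] and [-(n + C), n + C]: a parameter in the first window is
   moved by at most [C], hence stays in the second. *)
have key (n : nat) : Leb ((fun e => e + g e *: u)%R @^-1` A) * (n%:R + n%:R)%:E <=
    K%:E * Leb A * ((n%:R + C) + (n%:R + C))%:E.
  have itvE (r : R) : (0 <= r)%R -> lam `[(- r)%R, r]%classic = (r + r)%:E.
    move=> r0; rewrite lebesgue_measure_itv/=; case: ifPn => [_|].
      by rewrite -EFinB opprK.
    by rewrite lte_fin -leNgt => rr; congr (_%:E); lra.
  rewrite -itvE// -[X in _ <= _ * X]itvE ?addr_ge0// -muleA.
  rewrite (lebesgue_rV_average u) // (lebesgue_rV_average u) //.
  rewrite -ge0_integralZl//; last 2 first.
  - exact: measurable_line_measure.
  - by rewrite lee_fin ltW.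
  apply: ge0_le_integral => //.
  - exact: measurable_line_measure.
  - by apply: measurable_funeM; exact: measurable_line_measure.
  move=> e _.
  have mBe B : measurable B -> measurable [set s | B (e + s *: u)%R].
    by move=> mB; rewrite -[X in measurable X]setTI; exact: mline.
  have mk : measurable_fun setT (fun s : R => s + g (e + s *: u))%R.
    by apply: measurable_funD => //; exact: measurableT_comp.
  have mI : measurable (`[(- (n%:R + C))%R, (n%:R + C)%R]%classic `&` [set s | A (e + s *: u)%R]).
    by apply: measurableI => //; exact: mBe.
  apply: le_trans (lebesgue_measure_expanding _ _ _ K0 mk (gK e) mI).
  rewrite le_measure ?inE//.
  - by apply: measurableI => //; exact: (mBe _ mUA).
  - by rewrite -[X in measurable X]setTI; exact: mk.
  - move=> s [/=]; rewrite !in_itv/= => /andP[s1 s2] As; split.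
      by have := gC (e + s *: u)%R; rewrite ler_norml => /andP[??]; apply/andP; split; lra.
    by rewrite /= scalerDl addrA.
have [->|] := eqVneq (Leb A) +oo; first by rewrite gt0_muley ?leey// lte_fin.
move=> AX; have Afin : Leb A \is a fin_num by rewrite ge0_fin_numE// ltey.
rewrite -(fineK Afin) -EFinM in key *.
have K1 : (0 < K * fine (Leb A) * (1 + C + (1 + C)) + 1)%R.
  by rewrite ltr_wpDl// mulr_ge0 ?mulr_ge0 ?fine_ge0// ?ltW// ; lra.
(* The estimate for n = 1 already shows that the preimage has finite measure, so the rest is real
   arithmetic. *)
have Ufin : Leb ((fun e => e + g e *: u)%R @^-1` A) \is a fin_num.
  rewrite ge0_fin_numE// ltNge leye_eq; apply/negP => /eqP UE.
  by have := key 1%N; rewrite UE -EFinM gt0_mulye ?leye_eq// lte_fin.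
rewrite -(fineK Ufin) in key *; move: key.
set b := fine _; set a := fine _ => key.
rewrite lee_fin leNgt; apply/negP => ab.
have ba : (0 < b - K * a)%R by rewrite subr_gt0.
(* With b and a the two measures, [key] says n (b - K a) <= K a C; this n violates it. *)
have [n] : exists n : nat, (K * a * C / (b - K * a) < n%:R)%R.
  by exists (Num.truncn (K * a * C / (b - K * a))).+1; exact: truncnS_gt.
rewrite ltr_pdivrMr// => nb.
by have := key n; rewrite -!EFinM lee_fin; nra.
Qed.

End lebesgue_rV.

(** * Null sets and locally Lipschitz maps *)

Section dominates_algebra.
Context d (T : measurableType d) (R : realType).
Variables (mu nu : {measure set T -> \bar R}) (C : R) (G : set (set T)).
Hypotheses (muT : (mu setT < +oo)%E) (nuT : (nu setT < +oo)%E) (C0 : 0 <= C).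
Hypotheses (GT : G setT) (GD : setD_closed G) (mG : G `<=` measurable).
Hypothesis Gmunu : forall B, G B -> (mu B <= C%:E * nu B)%E.
Local Open Scope ereal_scope.

Let symdiff (A B : set T) := (A `\` B) `|` (B `\` A).

Let measurable_symdiff A B : measurable A -> measurable B -> measurable (symdiff A B).
Proof. by move=> mA mB; apply: measurableU; exact: measurableD. Qed.

Let approx (m : {measure set T -> \bar R}) (A : set T) (e : R) (B : set T) :=
  m (symdiff A B) <= e%:E.

(** One set B must approximate A for both measures at once, so that the inequality known on [G] can
    be transferred. *)
Let H := [set A | measurable A /\ forall e : R, (0 < e)%R ->
  exists B, [/\ G B, approx mu A e B & approx nu A e B]].

Let approxD (m : {measure set T -> \bar R}) A B A' B' (e : R) :
  measurable A -> measurable B -> measurable A' -> measurable B' ->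
  approx m A (e / 2) A' -> approx m B (e / 2) B' -> approx m (A `\` B) e (A' `\` B').
Proof.
move=> mA mB mA' mB' hA hB; rewrite /approx.
apply: (@le_trans _ _ (m (symdiff A A' `|` symdiff B B'))).
  rewrite le_measure ?inE//.
  - by apply: measurable_symdiff; exact: measurableD.
  - by apply: measurableU; exact: measurable_symdiff.
  - move=> x; rewrite /symdiff /=; have := pselect (A x); have := pselect (B x).
    by have := pselect (A' x); have := pselect (B' x); tauto.
rewrite (le_trans (measureU2 _ _ _))//; try exact: measurable_symdiff.
by rewrite [leRHS](_ : _ = (e / 2)%:E + (e / 2)%:E) ?leeD// -EFinD -splitr.
Qed.

(** Continuity from above of a finite measure. The conclusion holds for all large n, so a common
    index can be chosen for the two measures. *)
Let approx_bigcup (m : {measure set T -> \bar R}) (F : (set T)^nat) (e : R) :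
  m setT < +oo -> (0 < e)%R -> (forall n, measurable (F n)) -> nondecreasing_seq F ->
  \forall n \near \oo, forall B, measurable B -> approx m (F n) (e / 2) B ->
    approx m (\bigcup_k F k) e B.
Proof.
move=> mT e0 mF ndF.
have mUF : measurable (\bigcup_k F k) by exact: bigcupT_measurable.
have cap0 : \bigcap_n ((\bigcup_k F k) `\` F n) = set0.
  by apply/seteqP; split => // x xF; have [[k _ Fkx] _] := xF 0%N I; have [] := xF k I.
have : m \o (fun n => (\bigcup_k F k) `\` F n) @ \oo --> m (\bigcap_n ((\bigcup_k F k) `\` F n)).
  apply: nonincreasing_cvg_mu.
  - rewrite (le_lt_trans _ mT)// le_measure ?inE//; exact: measurableD.
  - by move=> n; exact: measurableD.
  - by rewrite cap0.
  - by move=> a b ab; apply/subsetPset; apply: setDS; exact/subsetPset/ndF.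
rewrite cap0 measure0 => /(_ [set x | x < (e / 2)%:E]) h.
have {}h : \forall n \near \oo, m ((\bigcup_k F k) `\` F n) < (e / 2)%:E.
  apply: h; apply: open_nbhs_nbhs; split; first exact: open_ereal_lt_ereal.
  by rewrite /= lte_fin divr_gt0.
near=> n => B mB hB; rewrite /approx.
apply: (@le_trans _ _ (m (((\bigcup_k F k) `\` F n) `|` symdiff (F n) B))).
  rewrite le_measure ?inE//.
  - exact: measurable_symdiff.
  - by apply: measurableU; [exact: measurableD|exact: measurable_symdiff].
  - move=> x [[Fx Bx]|[Bx Fx]].
      have [Fnx|Fnx] := pselect (F n x); first by right; left.
      by left.
    by right; right; split => // Fnx; apply: Fx; exists n.
rewrite (le_trans (measureU2 _ _ _))//; [exact: measurableD|exact: measurable_symdiff|].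
rewrite [leRHS](_ : _ = (e / 2)%:E + (e / 2)%:E); last by rewrite -EFinD -splitr.
by rewrite leeD// ltW//; near: n.
Unshelve. all: by end_near. Qed.

Let lambda_system_approx : lambda_system setT H.
Proof.
split => //.
- split=> // e e0; exists setT; rewrite /approx /symdiff setDv setU0 !measure0.
  by split => //; rewrite lee_fin ltW.
- move=> A B BA [mA hA] [mB hB]; split; first exact: measurableD.
  move=> e e0; have e20 : (0 < e / 2)%R by rewrite divr_gt0.
  have [A' [GA' muA nuA]] := hA _ e20; have [B' [GB' muB nuB]] := hB _ e20.
  by exists (A' `\` B'); split; [exact: GD|apply: approxD => //; exact: mG..].
- move=> F ndF HF.
  have mF n : measurable (F n) by have [] := HF n.
  split; first exact: bigcupT_measurable.
  move=> e e0; have e20 : (0 < e / 2)%R by rewrite divr_gt0.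
  have := approx_bigcup _ _ _ muT e0 mF ndF; have := approx_bigcup _ _ _ nuT e0 mF ndF.
  move=> [N1 _ h1] [N2 _ h2].
  have [_ /(_ _ e20)[B [GB muB nuB]]] := HF (maxn N1 N2).
  exists B; split => //.
  - by apply: (h2 (maxn N1 N2)) => //=; [exact: leq_maxr|exact: mG].
  - by apply: (h1 (maxn N1 N2)) => //=; [exact: leq_maxl|exact: mG].
Qed.

(** An inequality on an algebra passes null sets to the generated sigma-algebra: a set B of [G]
    close to a [nu]-null A has small [nu B], hence small [mu B], hence A has small [mu]-measure. *)
Lemma dominates_algebra A : <<s G >> A -> nu A = 0 -> mu A = 0.
Proof.
move=> sGA nuA0.
have [mA hA] : H A.
  apply: (lambda_system_subset _ lambda_system_approx) sGA => //.
  - by have /setD_closedP[] := GD.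
  - move=> B GB; split; first exact: mG.
    move=> e e0; exists B; rewrite /approx /symdiff setDv setU0 !measure0.
    by split => //; rewrite lee_fin ltW.
apply/eqP; rewrite eq_le measure_ge0 andbT; apply/lee_addgt0Pr => e e0; rewrite add0e.
have C1 : (0 < 1 + C)%R by rewrite ltr_wpDr.
(* The tolerance e / (1 + C) is chosen for the final sum C e / (1 + C) + e / (1 + C) = e. *)
have [B [GB muB nuB]] := hA _ (divr_gt0 e0 C1).
have mB := mG _ GB; have mS := measurable_symdiff _ _ mA mB.
have sub (m : {measure set T -> \bar R}) X Y : measurable X -> measurable Y ->
    X `<=` Y `|` symdiff A B -> m X <= m Y + m (symdiff A B).
  move=> mX mY XY; rewrite (le_trans _ (measureU2 _ _ _))// le_measure ?inE//.
  exact: measurableU.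
apply: (le_trans (sub mu A B mA mB _)).
  by move=> x Ax; rewrite /symdiff /=; have [|] := pselect (B x); tauto.
have nuB' : nu B <= (e / (1 + C))%:E.
  rewrite -[leRHS]add0e -nuA0 (le_trans (sub nu B A mB mA _)) ?leeD2l//.
  by move=> x Bx; rewrite /symdiff /=; have [|] := pselect (A x); tauto.
apply: (@le_trans _ _ (C%:E * (e / (1 + C))%:E + (e / (1 + C))%:E)).
  by rewrite leeD// (le_trans (Gmunu _ GB))// lee_wpmul2l// lee_fin.
rewrite -EFinM -EFinD lee_fin le_eqVlt; apply/orP; left; apply/eqP.
by field; rewrite gt_eqF.
Qed.

End dominates_algebra.

(** * Dyadic cubes *)

Section dyadic_grid.
Context {R : realType} {d : nat}.

(** The index of the dyadic cube of side 2^-n that contains x. Ceilings match boxes that are open on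
    the left and closed on the right. *)
Definition grid (n : nat) (x : 'rV[R]_d) : 'rV[int]_d :=
  \row_i Num.ceil (2 ^+ n * x ord0 i).

(** Arbitrary unions of cubes of one common level. They form an algebra, since two levels have a
    common refinement. *)
Definition grid_sets : set (set 'rV[R]_d) :=
  [set B | exists n S, B = grid n @^-1` S].

Definition grid_cell (n : nat) (z : 'rV[int]_d) : set 'rV[R]_d :=
  box (\row_i ((z ord0 i - 1)%:~R / 2 ^+ n)) (\row_i ((z ord0 i)%:~R / 2 ^+ n)).

Lemma grid_cellE n z : grid_cell n z = grid n @^-1` [set z].
Proof.
have n0 : 0 < 2 ^+ n :> R by rewrite exprn_gt0.
apply/seteqP; split => [x xz|x xz i].
  apply/rowP => i; rewrite mxE; have := xz i; rewrite !mxE => h.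
  by apply: ceil_def; rewrite -ltr_pdivrMl// -ler_pdivlMl// ![_^-1 * _]mulrC.
rewrite -xz !mxE ltr_pdivrMr// ler_pdivlMr// ![x _ _ * _]mulrC.
exact: ceil_itv.
Qed.

Lemma grid_refine m n x y : (m <= n)%N -> grid n x = grid n y -> grid m x = grid m y.
Proof.
move=> mn /rowP h; apply/rowP => i; have := h i; rewrite !mxE.
rewrite -(subnK mn) exprD -!mulrA; move: (_ * x _ _) (_ * y _ _) => s t.
(* For integer k both sides say r <= k; thus the finer ceiling determines the coarser one. *)
have E (r : R) k : (Num.ceil r <= k) = (Num.ceil (2 ^+ (n - m) * r) <= 2 ^+ (n - m) * k).
  by rewrite !ceil_le_int rmorphM rmorphXn/= ler_pM2l ?exprn_gt0.
by move=> st; apply/le_anti/andP; split; rewrite E; [rewrite st|rewrite -st]; rewrite -E.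
Qed.

Lemma grid_preimage_refine m n (S : set 'rV[int]_d) : (m <= n)%N ->
  grid m @^-1` S = grid n @^-1` (grid n @` (grid m @^-1` S)).
Proof.
move=> mn; apply/seteqP; split => [x Sx|x [y Sy yx]]; first by exists x.
by rewrite /= -(grid_refine _ _ _ _ mn yx).
Qed.

Lemma grid_sets_setD : setD_closed grid_sets.
Proof.
move=> _ _ [m [S ->]] [n [S' ->]].
exists (maxn m n), ((grid (maxn m n) @` (grid m @^-1` S)) `\`
  (grid (maxn m n) @` (grid n @^-1` S'))).
by rewrite {1}(grid_preimage_refine _ _ S (leq_maxl m n))
  {1}(grid_preimage_refine _ _ S' (leq_maxr m n)).
Qed.

(** Enumerates the cubes by the codes of their indices. The test [pickle z == k] discards numbers
    that decode to z without being its code, so no cube is listed twice. *)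
Let cell_seq (n : nat) (S : set 'rV[int]_d) (k : nat) : set 'rV[R]_d :=
  if (unpickle k : option 'rV[int]_d) is Some z then
    if (z \in S) && (pickle z == k) then grid_cell n z else set0
  else set0.

Let bigcup_cell_seq n S : grid n @^-1` S = \bigcup_k cell_seq n S k.
Proof.
apply/seteqP; split => x.
  move=> Sx; exists (pickle (grid n x)) => //.
  by rewrite /cell_seq pickleK eqxx mem_set//= grid_cellE.
move=> [k _]; rewrite /cell_seq; case: unpickle => // z.
by case: ifP => // /andP[/set_mem Sz _]; rewrite grid_cellE /= => ->.
Qed.

Let cell_seqP n S k : cell_seq n S k = set0 \/ exists z, cell_seq n S k = grid_cell n z.
Proof.
rewrite /cell_seq; case: unpickle => [z|]; last by left.
by case: ifP => _; [right; exists z|left].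
Qed.

Let measurable_cell_seq n S k : measurable (cell_seq n S k).
Proof. by have [->//|[z ->]] := cell_seqP n S k; exact: measurable_box. Qed.

Let trivIset_cell_seq n S : trivIset setT (cell_seq n S).
Proof.
apply/trivIsetP => i j _ _ ij; apply/seteqP; split => // x [].
rewrite /cell_seq; case: unpickle => // z; case: ifP => // /andP[_ /eqP zi].
case: unpickle => // z'; case: ifP => // /andP[_ /eqP zj].
rewrite !grid_cellE /= => xz xz'.
by move: ij; rewrite -zi -zj -xz -xz' eqxx.
Qed.

Lemma measurable_grid_sets : grid_sets `<=` measurable.
Proof.
by move=> _ [n [S ->]]; rewrite bigcup_cell_seq; exact: bigcupT_measurable.
Qed.

Lemma grid_sets_le (mu nu : {measure set 'rV[R]_d -> \bar R}) (C : R) : 0 <= C ->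
  (forall n z, mu (grid_cell n z) <= C%:E * nu (grid_cell n z))%E ->
  forall B, grid_sets B -> (mu B <= C%:E * nu B)%E.
Proof.
move=> C0 munu _ [n [S ->]].
rewrite bigcup_cell_seq !measure_bigcup// -nneseriesZl//.
apply: lee_nneseries => // k _.
have [->|[z ->]] := cell_seqP n S k; last exact: munu.
by rewrite !measure0 mule0.
Qed.

Lemma grid_sets_generate : @measurable _ 'rV[R]_d `<=` <<s grid_sets >>.
Proof.
apply: rV_measurable_sub; first exact: smallest_sigma_algebra.
move=> i a.
(* The shift by 1 selects cubes lying wholly to the right of a, as a cube with index z starts at (z
   - 1) / 2^n. *)
rewrite [X in _ X](_ : _ = \bigcup_n (grid n @^-1` [set z | 2 ^+ n * a + 1 < (z ord0 i)%:~R])).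
  by apply: sigma_algebra_bigcup => n; apply: sub_sigma_algebra; exists n; eexists.
apply/seteqP; split => x /=.
  move=> ax; have xa : 0 < x ord0 i - a by rewrite subr_gt0.
  (* This n exceeds 1 / (x_i - a), and 2^n > n, so 2^n (x_i - a) > 1. *)
  exists (Num.truncn (x ord0 i - a)^-1).+1 => //=; set n := _.+1.
  rewrite mxE (lt_le_trans _ (ceil_ge _))//.
  rewrite -ltrBrDl -mulrBr -ltr_pdivrMr// mul1r.
  rewrite (lt_trans (truncnS_gt _))// -/n -natrX ltr_nat.
  exact: ltn_expl.
move=> [n _ /=]; rewrite mxE => h.
have := ceilB1_lt (2 ^+ n * x ord0 i); rewrite intrB => h'.
have : 2 ^+ n * a < 2 ^+ n * x ord0 i by lra.
by rewrite ltr_pM2l// exprn_gt0.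
Qed.

End dyadic_grid.

Section null_preimage.
Context {R : realType} {d : nat} (Leb : {measure set 'rV[R]_d -> \bar R}).
Hypothesis hL : is_lebesgue_rV Leb.

Lemma lebesgue_rV_diam (E : set 'rV[R]_d) (D : R) : measurable E -> 0 < D ->
  (forall e e' i, E e -> E e' -> `|e ord0 i - e' ord0 i| <= D) ->
  (Leb E <= ((3 * D) ^+ d)%:E)%E.
Proof.
move=> mE D0 ED; have [->|/set0P[e0 Ee0]] := eqVneq E set0.
  by rewrite measure0 lee_fin exprn_ge0// mulr_ge0// ltW.
(* Boxes exclude their left faces, so a margin 2 D is left on that side; this is the origin of the
   factor 3. *)
pose a := e0 - const_mx (2 * D); pose b := e0 + const_mx D.
apply: (@le_trans _ _ (Leb (box a b))).
  rewrite le_measure ?inE//; first exact: measurable_box.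
  move=> e Ee i; have := ED _ _ i Ee Ee0; rewrite !mxE ler_norml => /andP[h1 h2].
  by apply/andP; split; lra.
rewrite hL; last by move=> i; rewrite !mxE; lra.
rewrite lee_fin (eq_bigr (fun=> 3 * D)); last by move=> i _; rewrite !mxE; ring.
by rewrite prodr_const card_ord.
Qed.

Lemma lebesgue_grid_cell n z : Leb (grid_cell n z) = ((2 ^+ n)^-1 ^+ d)%:E.
Proof.
rewrite hL; last first.
  by move=> i; rewrite !mxE ler_pM2r ?invr_gt0 ?exprn_gt0// ler_int; lra.
congr (_%:E); rewrite (eq_bigr (fun=> (2 ^+ n)^-1)).
  by rewrite prodr_const card_ord.
by move=> i _; rewrite !mxE intrB; field; rewrite gt_eqF ?exprn_gt0.
Qed.

(** The hypothesis says that on each cube the inverse of [F] is Lipschitz on the range of [F].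
    Preimages of small cubes then have volume at most a constant times the volume of the cube, and
    [dominates_algebra] applies. *)
Lemma lebesgue_rV_null_preimage (F : 'rV[R]_d -> 'rV[R]_d) : measurable_fun setT F ->
  (forall r : nat, exists2 L : R, 0 < L & forall e e' D,
     cube r%:R (F e) -> cube r%:R (F e') ->
     (forall i, `|F e ord0 i - F e' ord0 i| <= D) ->
     forall i, `|e ord0 i - e' ord0 i| <= L * D) ->
  forall N, measurable N -> Leb N = 0%E -> Leb (F @^-1` N) = 0%E.
Proof.
move=> mF hF N mN N0.
have mFB B : measurable B -> measurable (F @^-1` B).
  by move=> mB; rewrite -[X in measurable X]setTI; exact: mF.
pose mfF : {mfun 'rV[R]_d >-> 'rV[R]_d} := HB.pack F (isMeasurableFun.Build _ _ _ _ _ mF).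
have -> : F @^-1` N = \bigcup_(r : nat) (F @^-1` (N `&` cube r%:R)).
  by rewrite -preimage_bigcup -setI_bigcupr bigcup_cube setIT.
apply/eqP; rewrite eq_le measure_ge0 andbT.
rewrite (le_trans (measure_sigma_subadditive Leb _ _ (@subset_refl _ _)))//.
- by move=> r; apply: mFB; apply: measurableI => //; exact: measurable_box.
- by apply: bigcupT_measurable => r; apply: mFB; apply: measurableI => //; exact: measurable_box.
rewrite eseries0// => r _ _.
have mr : measurable (cube r%:R : set 'rV[R]_d) by exact: measurable_box.
have mr1 : measurable (cube (r%:R + 1) : set 'rV[R]_d) by exact: measurable_box.
have [L L0 hFr] := hF r.
(* The larger cube in [nu] is needed because a dyadic cube, of side at most 1, that meets [cube r]
   may stick out of it but stays inside [cube (r + 1)]. *)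
pose mu := mrestr (pushforward Leb mfF) mr; pose nu := mrestr Leb mr1.
have diam D : 0 < D -> forall Q : set 'rV[R]_d, measurable Q ->
    (forall f f' : 'rV[R]_d, Q f -> Q f' -> forall i, `|f ord0 i - f' ord0 i| <= D) ->
    (mu Q <= ((3 * (L * D)) ^+ d)%:E)%E.
  move=> D0 Q mQ QD; rewrite /mu /mrestr /pushforward; apply: lebesgue_rV_diam.
  - by apply: mFB; exact: measurableI.
  - by rewrite mulr_gt0.
  - by move=> e e' i [Qe re] [Qe' re']; apply: hFr => //; exact: QD.
have : mu N = 0%E; last by [].
apply: (@dominates_algebra _ _ _ mu nu ((3 * L) ^+ d) grid_sets).
- rewrite [X in (X < _)%E](_ : _ = mu (cube r%:R)); last by rewrite /= /mu /mrestr setTI setIid.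
  apply: (@le_lt_trans _ _ ((3 * (L * (r%:R + r%:R + 1))) ^+ d)%:E); last exact: ltry.
  have D0 : 0 < r%:R + r%:R + 1 :> R by rewrite ltr_wpDl// addr_ge0.
  apply: (diam _ D0) => //.
  move=> f f' /cubeP Qf /cubeP Qf' i; have /andP[h1 h2] := Qf i; have /andP[h3 h4] := Qf' i.
  by rewrite ler_norml; apply/andP; split; lra.
- by rewrite /= /mrestr setTI; exact: lebesgue_box_lty.
- by rewrite exprn_ge0// mulr_ge0// ltW.
- by exists 0%N, setT.
- exact: grid_sets_setD.
- exact: measurable_grid_sets.
- apply: grid_sets_le; first by rewrite exprn_ge0// mulr_ge0// ltW.
  move=> n z.
  have n0 : 0 < (2 ^+ n)^-1 :> R by rewrite invr_gt0 exprn_gt0.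
  have cellD (f f' : 'rV[R]_d) : grid_cell n z f -> grid_cell n z f' ->
      forall i, `|f ord0 i - f' ord0 i| <= (2 ^+ n)^-1.
    move=> zf zf' i; have := zf i; have := zf' i; rewrite !mxE intrB mulrBl div1r.
    by move=> /andP[h1 h2] /andP[h3 h4]; rewrite ler_norml; apply/andP; split; lra.
  have [Q0|/set0P[f [zf rf]]] := eqVneq (grid_cell n z `&` cube r%:R : set 'rV[R]_d) set0.
    rewrite [X in (X <= _)%E](_ : _ = 0%E); last first.
      by rewrite /= /mrestr Q0 /pushforward preimage_set0 measure0.
    by rewrite mule_ge0// lee_fin exprn_ge0// mulr_ge0// ltW.
  rewrite (le_trans (diam _ n0 _ _ cellD))//; first exact: measurable_box.
  rewrite [X in (_ <= _ * X)%E](_ : _ = Leb (grid_cell n z)); last first.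
    rewrite /= /mrestr setIidl// => f' zf'; apply/cubeP => i.
    have := cellD _ _ zf zf' i; rewrite ler_norml => /andP[h1 h2].
    have /cubeP/(_ i)/andP[h3 h4] := rf.
    have : (2 ^+ n)^-1 <= 1 :> R by rewrite invf_le1 ?exprn_gt0// exprn_ege1// ler1n.
    by move=> h5; apply/andP; split; lra.
  by rewrite lebesgue_grid_cell -EFinM lee_fin mulrA exprMn.
- exact: grid_sets_generate.
- apply/eqP; rewrite eq_le measure_ge0 andbT -N0 /= /mrestr le_measure ?inE//.
  exact: measurableI.
Qed.

End null_preimage.

(** * Euclidean structure *)

Section euclidean.
Context {R : realType} {d : nat}.
Implicit Types u v w : 'rV[R]_d.

Lemma dotpC u v : dotp u v = dotp v u.
Proof. by apply: eq_bigr => i _; rewrite mulrC. Qed.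

Lemma dotpDl u v w : dotp (u + v) w = dotp u w + dotp v w.
Proof. by rewrite -big_split; apply: eq_bigr => i _; rewrite mxE mulrDl. Qed.

Lemma dotpZl (a : R) u w : dotp (a *: u) w = a * dotp u w.
Proof. by rewrite mulr_sumr; apply: eq_bigr => i _; rewrite mxE mulrA. Qed.

Lemma dotpDr u v w : dotp w (u + v) = dotp w u + dotp w v.
Proof. by rewrite dotpC dotpDl !(dotpC w). Qed.

Lemma dotpZr (a : R) u w : dotp w (a *: u) = a * dotp w u.
Proof. by rewrite dotpC dotpZl dotpC. Qed.

Lemma dotpNl u w : dotp (- u) w = - dotp u w.
Proof. by rewrite -scaleN1r dotpZl mulN1r. Qed.

Lemma dotpNr u w : dotp w (- u) = - dotp w u.
Proof. by rewrite dotpC dotpNl dotpC. Qed.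

Lemma dotp0l w : dotp 0 w = 0.
Proof. by rewrite -(scale0r 0) dotpZl mul0r. Qed.

Lemma dotp_suml (n : nat) (F : 'I_n -> 'rV[R]_d) w :
  dotp (\sum_(j < n) F j) w = \sum_(j < n) dotp (F j) w.
Proof. by apply: (big_morph (fun u => dotp u w)) => [u v|]; rewrite ?dotpDl ?dotp0l. Qed.

Definition dotpE := (dotpDl, dotpDr, dotpZl, dotpZr, dotpNl, dotpNr).

Lemma dotp_basis u (i : 'I_d) : dotp u (ebasis i) = u ord0 i.
Proof.
rewrite /dotp (bigD1 i)//= big1 => [|j ji]; rewrite !mxE !eqxx ?mulr1 ?addr0//.
by rewrite (negbTE ji) mulr0.
Qed.

Lemma enorm_sq u : enorm u ^+ 2 = dotp u u.
Proof.
rewrite sqr_sqrtr; first by apply: eq_bigr => i _; rewrite expr2.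
by apply: sumr_ge0 => i _; rewrite sqr_ge0.
Qed.

Lemma enorm_ge0 u : 0 <= enorm u. Proof. exact: sqrtr_ge0. Qed.

Lemma dotpp_ge0 u : 0 <= dotp u u. Proof. by rewrite -enorm_sq sqr_ge0. Qed.

Lemma enormB u v : enorm (u - v) = enorm (v - u).
Proof.
by rewrite /enorm; congr Num.sqrt; apply: eq_bigr => i _; rewrite !mxE -opprB sqrrN.
Qed.

Lemma coord_le_enorm u (i : 'I_d) : `|u ord0 i| <= enorm u.
Proof.
rewrite -sqrtr_sqr ler_wsqrtr// (bigD1 i)//= lerDl.
by apply: sumr_ge0 => j _; rewrite sqr_ge0.
Qed.

(** Cauchy-Schwarz, from the squared norm of (v.v) u - (u.v) v. *)
Lemma dotp_sq_le u v : dotp u v ^+ 2 <= dotp u u * dotp v v.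
Proof.
have [v0|v0] := eqVneq (dotp v v) 0.
  suff -> : dotp u v = 0 by rewrite expr0n /= mulr_ge0 ?dotpp_ge0.
  apply: big1 => i _; have : `|v ord0 i| <= 0.
    by rewrite (le_trans (coord_le_enorm _ _))// -ler_sqr ?nnegrE ?enorm_ge0// enorm_sq v0 expr0n.
  by rewrite normr_le0 => /eqP ->; rewrite mulr0.
have vv : 0 < dotp v v by rewrite lt_neqAle eq_sym v0 dotpp_ge0.
have := dotpp_ge0 (dotp v v *: u - dotp u v *: v); rewrite !dotpE (dotpC v u) => h.
have {h} : 0 <= dotp v v * (dotp u u * dotp v v - dotp u v ^+ 2) by lra.
by rewrite pmulr_rge0// subr_ge0.
Qed.

Lemma dotp_le_enorm u v : `|dotp u v| <= enorm u * enorm v.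
Proof.
rewrite -ler_sqr ?nnegrE ?mulr_ge0 ?enorm_ge0// real_normK ?num_real//.
by rewrite exprMn !enorm_sq dotp_sq_le.
Qed.

Lemma enormD u v : enorm (u + v) <= enorm u + enorm v.
Proof.
rewrite -ler_sqr ?nnegrE ?addr_ge0 ?enorm_ge0// sqrrD !enorm_sq !dotpE (dotpC v u).
have := le_trans (ler_norm _) (dotp_le_enorm u v); lra.
Qed.

Lemma enormZ (a : R) u : enorm (a *: u) = `|a| * enorm u.
Proof.
apply/eqP; rewrite -(@eqrXn2 _ 2)// ?mulr_ge0 ?enorm_ge0//.
by rewrite exprMn real_normK ?num_real// !enorm_sq !dotpE mulrA expr2.
Qed.

Lemma enorm_le_sum u : enorm u <= \sum_i `|u ord0 i|.
Proof.
have S0 : 0 <= \sum_i `|u ord0 i| by apply: sumr_ge0.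
rewrite -ler_sqr ?nnegrE ?enorm_ge0// enorm_sq expr2 mulr_sumr.
apply: ler_sum => i _; rewrite -expr2 -real_normK ?num_real// expr2.
by rewrite ler_wpM2r// (bigD1 i)//= lerDl sumr_ge0.
Qed.

Lemma rational_dense (x : 'rV[R]_d) (e : R) : 0 < e ->
  exists q : 'rV[rat]_d, enorm (x - map_mx ratr q) < e.
Proof.
move=> e0; have D0 : 0 < e / (d%:R + 1) by rewrite divr_gt0// ltr_wpDl.
have /choice[q hq] : forall i : 'I_d, exists q : rat, `|x ord0 i - ratr q| <= e / (d%:R + 1).
  move=> i; have lt_x : x ord0 i - e / (d%:R + 1) < x ord0 i by rewrite ltrBlDr ltrDl.
  have [q] := rat_in_itvoo lt_x.
  rewrite in_itv/= => /andP[h1 h2]; exists q; rewrite ler_norml; apply/andP; split; lra.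
exists (\row_i q i); apply: (le_lt_trans (enorm_le_sum _)).
apply: (@le_lt_trans _ _ (\sum_(i < d) (e / (d%:R + 1)))).
  by apply: ler_sum => i _; rewrite !mxE.
rewrite sumr_const card_ord -mulr_natr -subr_gt0.
have d1 : 0 < d%:R + 1 :> R by rewrite ltr_wpDl.
rewrite (_ : _ - _ = e / (d%:R + 1)) ?divr_gt0//; field.
by rewrite gt_eqF.
Qed.

(** The sigma-algebra is generated by coordinates, not by open sets. A Lipschitz f is the supremum
    over rational points q of the functions f q - L |x - q|, so its superlevel sets are countable
    unions of measurable sets. *)
Lemma lipschitz_measurable (f : 'rV[R]_d -> R) (L : R) : 0 <= L ->
  (forall x y, `|f x - f y| <= L * enorm (x - y)) -> measurable_fun setT f.
Proof.
move=> L0 fL.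
have msub (q : 'rV[R]_d) : measurable_fun setT (fun x : 'rV[R]_d => f q - L * enorm (x - q)).
  apply: measurable_funB => //; apply: measurable_funM => //.
  exact: measurableT_comp measurable_enorm (measurable_rV_add (- q)).
move=> _; apply: (measurability _ (RGenOInfty.measurableE R)) => //.
move=> _ [_ [a ->] <-]; rewrite setTI.
pose S k : set 'rV[R]_d := if (unpickle k : option 'rV[rat]_d) is Some q then
   [set x | a < f (map_mx ratr q) - L * enorm (x - map_mx ratr q)] else set0.
rewrite (_ : f @^-1` _ = \bigcup_k S k).
  apply: bigcupT_measurable => k; rewrite /S; case: unpickle => // q.
  have := msub (map_mx ratr q) measurableT `]a, +oo[%classic (measurable_itv _).
  by rewrite setTI; congr measurable; apply/seteqP; split => x /=; rewrite in_itv/= andbT.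
apply/seteqP; split => x /=; rewrite in_itv/= andbT.
  (* The radius below makes 2 L |x - q| smaller than f x - a, which pays for both f x - f q and the
     subtracted cone. *)
  move=> ax; have L1 : 0 < 2 * (L + 1) by rewrite mulr_gt0// ltr_wpDl.
  have e0 : 0 < (f x - a) / (2 * (L + 1)) by rewrite divr_gt0 ?subr_gt0.
  have [q xq] := rational_dense x _ e0.
  exists (pickle q) => //; rewrite /S pickleK /=.
  move: xq; rewrite ltr_pdivlMr// => xq.
  have := fL x (map_mx ratr q); rewrite ler_norml => /andP[_].
  have := enorm_ge0 (x - map_mx ratr q); nra.
move=> [k _]; rewrite /S; case: unpickle => // q /=.
have := fL (map_mx ratr q) x; rewrite enormB ler_norml => /andP[_]; lra.
Qed.

End euclidean.

(** * Calculus and convexity *)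

Section calculus.
Context {R : realType} {d : nat}.
Implicit Types (g J h : 'rV[R]_d -> R) (x y z v : 'rV[R]_d).

Lemma is_derive_line g z v (t : R) : derivable g (z + t *: v) v ->
  is_derive t 1 (fun s : R => g (z + s *: v)) ('D_v g (z + t *: v)).
Proof.
have E : (fun h : R => h^-1 *: (((fun s : R => g (z + s *: v)) \o shift t) (h *: 1) -
      g (z + t *: v))) =
    (fun h : R => h^-1 *: ((g \o shift (z + t *: v)) (h *: v) - g (z + t *: v))).
  apply/funext => h /=; congr (_ *: (g _ - _)).
  by rewrite [h%:A]mulr1 scalerDl addrCA.
by move=> dg; split; [rewrite /derivable E|rewrite /derive E].
Qed.

Lemma line_mean_value g z v (a b M : R) : a <= b ->
  (forall t, derivable g (z + t *: v) v) ->
  (forall t, a <= t <= b -> `|'D_v g (z + t *: v)| <= M) ->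
  `|g (z + b *: v) - g (z + a *: v)| <= M * (b - a).
Proof.
move=> ab dg gM.
have [||c /= cab ->] := @MVT_segment R (fun s => g (z + s *: v))
    (fun s => 'D_v g (z + s *: v)) a b ab.
- by move=> t _; exact: is_derive_line.
- apply: derivable_within_continuous => t _.
  by have [] := is_derive_line _ _ _ _ (dg t).
rewrite normrM [`|b - a|]ger0_norm ?subr_ge0// ler_wpM2r ?subr_ge0//.
by apply: gM; move: cab; rewrite in_itv.
Qed.

Definition sup_ball (r : R) : set 'rV[R]_d := [set x | forall i, `|x ord0 i| <= r].

Lemma compact_sup_ball r : compact (sup_ball r).
Proof.
have := @rV_compact R d (fun=> `[- r, r]%classic) (fun=> @segment_compact R (- r) r).
congr compact; apply/seteqP; split => x h i; have := h i; rewrite /= in_itv/= ler_norml //.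
Qed.

(** Only partial derivatives are available, so x is turned into y one coordinate at a time, with the
    one-variable mean value theorem at each step; a box contains all intermediate points and, being
    compact, bounds the partial derivatives. *)
Lemma C1_lipschitz g (r : R) : (forall i x, derivable g x (ebasis i)) ->
  (forall i, continuous (fun x => 'D_(ebasis i) g x)) ->
  exists2 L, 0 <= L & forall x y, sup_ball r x -> sup_ball r y ->
    `|g x - g y| <= L * enorm (x - y).
Proof.
move=> dg cg.
have [/eqP r0|/set0P r0] := boolP (sup_ball r == set0).
  by exists 0 => // x y; rewrite r0.
have /choice[M hM] : forall i : 'I_d, exists M : R, forall x, sup_ball r x ->
    `|'D_(ebasis i) g x| <= M.
  move=> i; have [c _ hc] := EVT_max_rV (f := fun x => `|'D_(ebasis i) g x|) r0
    (@compact_sup_ball r) (continuous_subspaceT (fun x => cvg_norm (cg i x))).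
  by exists `|'D_(ebasis i) g c| => x rx; apply: hc; rewrite inE.
have M0 i : 0 <= M i by have [x rx] := r0; exact: le_trans (hM i x rx).
exists (\sum_i M i); first exact: sumr_ge0.
move=> x y rx ry.
(* The path: the first k coordinates are already those of y. *)
pose z k : 'rV[R]_d := \row_i if (i < k)%N then y ord0 i else x ord0 i.
have z0 : z 0%N = x by apply/rowP => i; rewrite mxE.
have zd : z d = y by apply/rowP => i; rewrite mxE ltn_ord.
have step (i : 'I_d) : `|g (z i.+1) - g (z i)| <= M i * `|y ord0 i - x ord0 i|.
  have zS : z i.+1 = z i + (y ord0 i - x ord0 i) *: ebasis i.
    apply/rowP => j; rewrite !mxE eqxx /= ltnS.
    have [->|ji] := eqVneq j i; first by rewrite leqnn ltnn mulr1 addrC subrK.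
    by rewrite mulr0 addr0 leq_eqVlt (inj_eq val_inj) (negbTE ji).
  have zr t : (0 <= t <= y ord0 i - x ord0 i) || (y ord0 i - x ord0 i <= t <= 0) ->
      sup_ball r (z i + t *: ebasis i).
    move=> ht j; rewrite !mxE eqxx /=; have [ji|ji] := eqVneq j i.
      rewrite ji ltnn mulr1; have := rx i; have := ry i; rewrite !ler_norml.
      move=> /andP[h1 h2] /andP[h3 h4]; apply/andP.
      by case/orP: ht => /andP[h5 h6]; split; lra.
    by rewrite mulr0 addr0; case: ifP => _; [exact: ry|exact: rx].
  have [xy|/ltW xy] := leP 0 (y ord0 i - x ord0 i).
    have := @line_mean_value g (z i) (ebasis i) 0 _ (M i) xy (fun t => dg i _).
    rewrite scale0r addr0 subr0 -zS [`|y _ _ - _|]ger0_norm//; apply.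
    by move=> t ht; apply: hM; apply: zr; rewrite ht.
  have := @line_mean_value g (z i) (ebasis i) _ 0 (M i) xy (fun t => dg i _).
  rewrite scale0r addr0 sub0r -zS [`|y _ _ - _|]ler0_norm// distrC; apply.
  by move=> t ht; apply: hM; apply: zr; rewrite ht orbT.
rewrite distrC -{1}zd -{1}z0 -(telescope_sumr (fun k => g (z k)))// big_mkord.
rewrite (le_trans (ler_norm_sum _ _ _))// mulr_suml; apply: ler_sum => i _.
rewrite (le_trans (step i))// ler_wpM2l// enormB.
by have := coord_le_enorm (y - x) i; rewrite !mxE.
Qed.

Lemma lipschitz_sup_ball_continuous g :
  (forall r, exists2 L, 0 <= L & forall x y, sup_ball r x -> sup_ball r y ->
    `|g x - g y| <= L * enorm (x - y)) -> continuous g.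
Proof.
move=> gL x; apply/(@cvgrPdist_lt R R^o _ (nbhs x) (nbhs_filter x)) => e e0.
have coord (y : 'rV[R]_d) i : `|y ord0 i| <= `|y|.
  rewrite [leRHS]/Num.norm /= mx_normrE; apply/bigmax_geP; right.
  by exists (ord0, i).
have [L L0 hL] := gL (`|x| + 1).
have D0 : 0 < L * d%:R + 1 by rewrite ltr_wpDl// mulr_ge0.
have nb (D : R) : 0 < D -> nbhs x (fun y => `|x - y| < D).
  by move=> D_gt0; exact: (nbhs_ball_norm x (PosNum D_gt0)).
have e1 : 0 < e / (L * d%:R + 1) by rewrite divr_gt0.
apply: (@filterS2 _ (nbhs x) (nbhs_filter x) _ _ _ _ (nb _ e1) (nb _ ltr01)) => y xy xy1.
have := hL x y; move=> /(_ _ _)/le_lt_trans; apply.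
- by move=> i; rewrite (le_trans (coord _ _))// lerDl.
- move=> i; rewrite (le_trans (coord _ _))//.
  by rewrite -[X in `|X|](subKr x) opprB addrC (le_trans (ler_normD _ _))// distrC; lra.
apply: (@le_lt_trans _ _ (L * d%:R * `|x - y|)).
  rewrite -mulrA ler_wpM2l// (le_trans (enorm_le_sum _))//.
  rewrite (le_trans (ler_sum _ (fun i _ => coord (x - y) i)))//.
  by rewrite sumr_const card_ord mulr_natl.
by move: xy; rewrite ltr_pdivlMr//; have := normr_ge0 (x - y); lra.
Qed.

End calculus.

(** * Strong convexity and existence of minimizers *)

Section convexity.
Context {R : realType} {d : nat}.
Implicit Types (J h : 'rV[R]_d -> R) (e f g v w x y : 'rV[R]_d) (m c : R).

(** The modulus is any real number: m = 0 is convexity, and moduli of quadratic terms add up without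
    a sign condition on their coefficients. *)
Definition strongly_convex m J := forall x y (t : R), 0 <= t <= 1 ->
  J (t *: x + (1 - t) *: y) <=
    t * J x + (1 - t) * J y - m / 2 * t * (1 - t) * enorm (x - y) ^+ 2.

Definition minimizes J f := forall g, J f <= J g.

Lemma strongly_convexD m m' J J' : strongly_convex m J -> strongly_convex m' J' ->
  strongly_convex (m + m') (fun f => J f + J' f).
Proof.
by move=> hJ hJ' x y t t01; have := hJ x y t t01; have := hJ' x y t t01; lra.
Qed.

Lemma strongly_convexZ m c J : 0 <= c -> strongly_convex m J ->
  strongly_convex (c * m) (fun f => c * J f).
Proof.
by move=> c0 hJ x y t t01; have := ler_wpM2l c0 (hJ x y t t01); lra.
Qed.

Lemma strongly_convex_dotp w : strongly_convex 0 (dotp w).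
Proof. by move=> x y t _; rewrite !dotpE; lra. Qed.

Lemma strongly_convex_sum (n : nat) (J : 'I_n -> 'rV[R]_d -> R) (m : 'I_n -> R) :
  (forall j, strongly_convex (m j) (J j)) ->
  strongly_convex (\sum_j m j) (fun f => \sum_j J j f).
Proof.
move=> hJ x y t t01.
rewrite !mulr_sumr -big_split /= !mulr_suml -sumrB; apply: ler_sum => j _.
exact: hJ.
Qed.

Lemma strongly_convex_sq (k : R) (a : 'rV[R]_d) :
  strongly_convex (2 * k) (fun f => k * enorm (f - a) ^+ 2).
Proof.
move=> x y t _; rewrite !enorm_sq !dotpE ?(dotpC a x) ?(dotpC a y) ?(dotpC y x).
by rewrite le_eqVlt; apply/orP; left; apply/eqP; field.
Qed.

(** Strong convexity between g and the minimizer f, at the point t g + (1 - t) f, gives A (1 - t) <=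
    J g - J f for every t in ]0, 1]. *)
Lemma minimizes_growth m J f g : 0 <= m -> strongly_convex m J -> minimizes J f ->
  J f + m / 2 * enorm (g - f) ^+ 2 <= J g.
Proof.
move=> m0 hJ Jf; set A := m / 2 * _; rewrite leNgt; apply/negP => lt.
have A0 : 0 <= A by rewrite mulr_ge0 ?sqr_ge0 ?divr_ge0.
have D0 := Jf g.
have {A0} A0 : 0 < A by lra.
(* For this t, A (1 - t) is the midpoint of A and J g - J f, hence exceeds J g - J f. *)
pose t := (A - (J g - J f)) / (2 * A).
have tA : t * (2 * A) = A - (J g - J f).
  by rewrite divfK// gt_eqF// mulr_gt0.
have t0 : 0 < t by apply: divr_gt0; [rewrite subr_gt0; lra|rewrite mulr_gt0].
have t1 : t <= 1 by nra.
have := le_trans (Jf _) (hJ g f t _); rewrite (ltW t0) t1 => /(_ isT).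
move=> h.
have {h} : 0 <= t * ((J g - J f) - A * (1 - t)) by rewrite /A; lra.
rewrite pmulr_rge0//; nra.
Qed.

Lemma minimizes_unique m J f g : 0 < m -> strongly_convex m J ->
  minimizes J f -> minimizes J g -> f = g.
Proof.
move=> m0 hJ Jf Jg; have := minimizes_growth _ _ _ g (ltW m0) hJ Jf; have := Jg f => h h'.
have {h h'} : m / 2 * enorm (g - f) ^+ 2 <= 0 by lra.
rewrite pmulr_rle0 ?divr_gt0// => h; apply/rowP => i; apply/eqP.
rewrite -subr_eq0 -normr_le0 distrC.
have : enorm (g - f) <= 0.
  have := sqr_ge0 (enorm (g - f)); have := enorm_ge0 (g - f); nra.
by apply: le_trans; have := coord_le_enorm (g - f) i; rewrite !mxE.
Qed.

(** A minimizer on a large box is global. For n = |g| > 1, strong convexity on the segment from 0 to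
    g, evaluated at g / n in the unit box, gives J g >= J 0 + n (m (n - 1) / 2 - M), with M the drop
    of J from 0 to its minimum on the unit box. The radius 1 + 2 M / m makes the bracket
    nonnegative. *)
Lemma strongly_convex_minimizer m J : 0 < m -> strongly_convex m J -> continuous J ->
  exists f, minimizes J f.
Proof.
move=> m0 hJ cJ.
have inK (r : R) : 0 <= r -> sup_ball r (0 : 'rV[R]_d).
  by move=> r0 i; rewrite mxE normr0.
have Kmin (r : R) : 0 <= r ->
    exists2 f : 'rV[R]_d, sup_ball r f & forall g, sup_ball r g -> J f <= J g.
  move=> r0.
  have [f /set_mem rf fmin] := EVT_min_rV (ex_intro _ _ (inK r r0))
    (@compact_sup_ball R d r) (continuous_subspaceT cJ).
  by exists f => // g rg; apply: fmin; rewrite inE.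
have [f1 _ f1min] := Kmin 1 ler01.
pose M := J 0 - J f1.
have M0 : 0 <= M by rewrite subr_ge0 f1min//; exact: inK.
have rho0 : 0 <= 1 + 2 * M / m by rewrite addr_ge0// divr_ge0 ?mulr_ge0// ltW.
have [f rf fmin] := Kmin _ rho0; exists f => g.
have [rg|/existsNP[i /negP]] := pselect (sup_ball (1 + 2 * M / m) g); first exact: fmin.
rewrite -ltNge => gi; apply: (le_trans (fmin _ (inK _ rho0))).
have := lt_le_trans gi (coord_le_enorm g i); set n := enorm g => ng.
have n1 : 1 < n by rewrite (le_lt_trans _ ng)// lerDl divr_ge0 ?mulr_ge0// ltW.
have n0 : 0 < n by lra.
have {}ng : 2 * M <= m * (n - 1).
  by move: ng; rewrite -ltrBrDl ltr_pdivrMr//; lra.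
have t01 : 0 <= n^-1 <= 1 by rewrite invr_ge0 ltW//= invf_le1// ltW.
have := hJ g 0 n^-1 t01; rewrite scaler0 addr0 subr0 -/n => h.
have : J f1 <= J (n^-1 *: g).
  apply: f1min => j; rewrite mxE normrM ger0_norm; last by rewrite invr_ge0 ltW.
  by rewrite mulrC ler_pdivrMr// mul1r coord_le_enorm.
move=> /le_trans/(_ h){h}.
rewrite -(@ler_pM2l _ n)// => h.
have E : n * (n^-1 * J g + (1 - n^-1) * J 0 - m / 2 * n^-1 * (1 - n^-1) * n ^+ 2) =
   J g + (n - 1) * J 0 - m / 2 * (n - 1) * n by field; rewrite gt_eqF.
rewrite E {E} in h; have : J f1 = J 0 - M by rewrite /M; lra.
move=> Jf1; rewrite Jf1 in h; nra.
Qed.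

End convexity.

(** * Gradients along lines and the first-order condition *)

Section directional_gradient.
Context {R : realType} {d : nat}.
Implicit Types (J h : 'rV[R]_d -> R) (e f g v w x y : 'rV[R]_d) (m c : R).

Lemma is_derive_slope_le (phi : R -> R) (a b : R) : is_derive (0 : R) 1 phi a ->
  (forall t : R, 0 < t <= 1 -> phi t - phi 0 <= t * b) -> a <= b.
Proof.
move=> [dphi <-] slope; rewrite /derive.
have dr := cvg_dnbhs_at_right dphi.
rewrite -(cvg_lim (@norm_hausdorff _ _) dr).
apply: limr_le; first exact: cvgP dr.
near=> t.
have t0 : 0 < t by near: t; exact: nbhs_right_gt.
have t1 : t <= 1 by near: t; exact: nbhs_right_le.
rewrite /= addr0 [t%:A]mulr1 [_ *: _]mulrC ler_pdivrMr// mulrC.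
by apply: slope; rewrite t0 t1.
Unshelve. all: by end_near. Qed.

(** A Gateaux gradient: derivatives along lines suffice for the first-order condition. *)
Definition dgrad h f w := forall v, is_derive (0 : R) 1 (fun t => h (f + t *: v)) (dotp w v).

Lemma dgradD h h' f w w' : dgrad h f w -> dgrad h' f w' ->
  dgrad (fun f => h f + h' f) f (w + w').
Proof. by move=> hw hw' v; rewrite dotpDl; exact: is_deriveD. Qed.

Lemma dgradZ h f w c : dgrad h f w -> dgrad (fun f => c * h f) f (c *: w).
Proof. by move=> hw v; rewrite dotpZl; exact: is_deriveZ. Qed.

Lemma dgrad_sum (n : nat) (h : 'I_n -> 'rV[R]_d -> R) f (w : 'I_n -> 'rV[R]_d) :
  (forall j, dgrad (h j) f (w j)) -> dgrad (fun f => \sum_j h j f) f (\sum_j w j).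
Proof.
move=> hw v; rewrite dotp_suml.
rewrite (_ : (fun _ => _) = \sum_j (fun t => h j (f + t *: v))).
  by apply: is_derive_sum => j; exact: hw.
by apply/funext => t; rewrite fct_sumE.
Qed.

Lemma dgrad_dotp f w : dgrad (dotp w) f w.
Proof.
move=> v; rewrite (_ : (fun _ => _) = (fun t : R => dotp w f + t * dotp w v)); last first.
  by apply/funext => t; rewrite !dotpE.
by apply: is_derive_eq; rewrite !add0r mul1r scaler0 add0r [LHS]mulr1.
Qed.

Lemma dgrad_sq (a f : 'rV[R]_d) : dgrad (fun f => enorm (f - a) ^+ 2) f (2 *: (f - a)).
Proof.
move=> v; rewrite (_ : (fun _ => _) = (fun t : R =>
   enorm (f - a) ^+ 2 + t * (2 * dotp (f - a) v) + t ^+ 2 * dotp v v)); last first.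
  by apply/funext => t; rewrite !enorm_sq !dotpE (dotpC v f) (dotpC v a); ring.
apply: is_derive_eq.
by rewrite !(scale0r, scaler0, addr0, add0r) mul1r [LHS]mulr1 !dotpE.
Qed.

Lemma dgrad_comp (l : R -> R) (a : R) f x : is_derive (dotp f x) (1 : R) l a ->
  dgrad (fun f => l (dotp f x)) f (a *: x).
Proof.
move=> dl v; rewrite (_ : (fun _ => _) = l \o (fun t : R => dotp f x + t * dotp v x)); last first.
  by apply/funext => t; rewrite /= !dotpE.
rewrite dotpZl (dotpC x); apply: is_derive1_comp.
  by rewrite mul0r addr0.
by apply: is_derive_eq; rewrite !add0r mul1r scaler0 add0r [LHS]mulr1.
Qed.

(** With f_t = f + t (g - f), convexity gives J g - J f >= (J f_t - J f) / t, minimality bounds this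
    below by -(h f_t - h f) / t, and t tends to 0. *)
Lemma minimizes_linearize J h f w : strongly_convex 0 J -> dgrad h f w ->
  minimizes (fun g => J g + h g) f -> minimizes (fun g => J g + dotp w g) f.
Proof.
move=> cJ hw fmin g /=.
suff : - dotp w (g - f) <= J g - J f by rewrite dotpDr dotpNr; lra.
rewrite -mulN1r -dotpZl.
apply: (is_derive_slope_le (fun t => (-1) * h (f + t *: (g - f)))).
  exact: dgradZ.
move=> t /andP[t0 t1] /=; rewrite scale0r addr0.
have := fmin (f + t *: (g - f)).
have := cJ g f t; rewrite t1 (ltW t0) => /(_ isT).
rewrite (_ : t *: g + (1 - t) *: f = f + t *: (g - f)); last first.
  by rewrite scalerBl scale1r scalerBr; apply/rowP => i; rewrite !mxE; ring.
lra.
Qed.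

End directional_gradient.

Section locally_lipschitz.
Context {R : realType} {d : nat}.
Implicit Types (g h : 'rV[R]_d -> R) (x y a w : 'rV[R]_d).

Definition locally_lipschitz g := forall r : R, exists2 L : R, 0 <= L &
  forall x y, sup_ball r x -> sup_ball r y -> `|g x - g y| <= L * enorm (x - y).

Lemma locally_lipschitzD g h : locally_lipschitz g -> locally_lipschitz h ->
  locally_lipschitz (fun x => g x + h x).
Proof.
move=> hg hh r; have [L L0 gL] := hg r; have [L' L'0 hL'] := hh r.
exists (L + L'); first exact: addr_ge0.
move=> x y rx ry; rewrite opprD addrACA (le_trans (ler_normD _ _))// mulrDl.
by rewrite lerD ?gL ?hL'.
Qed.

Lemma locally_lipschitzZ (k : R) g : locally_lipschitz g ->
  locally_lipschitz (fun x => k * g x).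
Proof.
move=> hg r; have [L L0 gL] := hg r; exists (`|k| * L); first exact: mulr_ge0.
by move=> x y rx ry; rewrite -mulrBr normrM -mulrA ler_wpM2l// gL.
Qed.

Lemma lipschitz_locally_lipschitz g (L : R) : 0 <= L ->
  (forall x y, `|g x - g y| <= L * enorm (x - y)) -> locally_lipschitz g.
Proof. by move=> L0 gL r; exists L. Qed.

Lemma locally_lipschitz_cst (k : R) : locally_lipschitz (fun=> k).
Proof.
apply: (@lipschitz_locally_lipschitz _ 0) => // x y.
by rewrite subrr normr0 mul0r.
Qed.

Lemma locally_lipschitz_sum (n : nat) (g : 'I_n -> 'rV[R]_d -> R) :
  (forall j, locally_lipschitz (g j)) -> locally_lipschitz (fun x => \sum_j g j x).
Proof.
elim: n g => [|n IH] g hg.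
  under eq_fun do rewrite big_ord0; exact: locally_lipschitz_cst.
under eq_fun do rewrite big_ord_recl; apply: locally_lipschitzD => //.
exact: IH.
Qed.

Lemma locally_lipschitz_dotp w : locally_lipschitz (dotp w).
Proof.
apply: (@lipschitz_locally_lipschitz _ (enorm w)); first exact: enorm_ge0.
by move=> x y; rewrite -dotpNr -dotpDr dotp_le_enorm.
Qed.

Lemma locally_lipschitz_coord (i : 'I_d) : locally_lipschitz (fun x => x ord0 i).
Proof.
apply: (@lipschitz_locally_lipschitz _ 1) => // x y.
by rewrite mul1r; have := coord_le_enorm (x - y) i; rewrite !mxE.
Qed.

Lemma locally_lipschitz_comp (l : R -> R) (L : R) w : 0 <= L ->
  (forall s t, `|l s - l t| <= L * `|s - t|) -> locally_lipschitz (fun x => l (dotp x w)).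
Proof.
move=> L0 lL; apply: (@lipschitz_locally_lipschitz _ (L * enorm w)).
  by rewrite mulr_ge0// enorm_ge0.
move=> x y; rewrite (le_trans (lL _ _))// -mulrA ler_wpM2l// mulrC.
by rewrite -dotpNl -dotpDl dotp_le_enorm.
Qed.

Lemma locally_lipschitz_sq a : locally_lipschitz (fun x => enorm (x - a) ^+ 2).
Proof.
move=> r; exists (2 * (d%:R * `|r| + enorm a)).
  by rewrite mulr_ge0// addr_ge0 ?mulr_ge0 ?enorm_ge0.
move=> x y rx ry.
have ball_le (z : 'rV[R]_d) : sup_ball r z -> enorm z <= d%:R * `|r|.
  move=> rz; rewrite (le_trans (enorm_le_sum _))//.
  rewrite [leRHS](_ : _ = \sum_(i < d) `|r|); last by rewrite sumr_const card_ord mulr_natl.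
  by apply: ler_sum => i _; apply: (le_trans (rz i)); exact: ler_norm.
rewrite !enorm_sq (_ : _ - _ = dotp (x - y) (x + y - 2 *: a)); last first.
  by rewrite !dotpE (dotpC a x) (dotpC a y) (dotpC y x); ring.
rewrite (le_trans (dotp_le_enorm _ _))// mulrC ler_wpM2r ?enorm_ge0//.
rewrite (le_trans (enormD _ _))// -scaleNr enormZ normrN ger0_norm//.
have := enormD x y; have := ball_le _ rx; have := ball_le _ ry; lra.
Qed.

(** A locally Lipschitz gradient is what makes the noise a locally Lipschitz function of the
    minimizer. *)
Definition smooth_with h (G : 'rV[R]_d -> 'rV[R]_d) :=
  (forall x, dgrad h x (G x)) /\ forall i, locally_lipschitz (fun x => G x ord0 i).

Lemma smooth_withD h h' G G' : smooth_with h G -> smooth_with h' G' ->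
  smooth_with (fun x => h x + h' x) (fun x => G x + G' x).
Proof.
move=> [hG GL] [hG' GL']; split => [x|i]; first exact: dgradD.
by under eq_fun do rewrite mxE; exact: locally_lipschitzD.
Qed.

Lemma smooth_withZ (k : R) h G : smooth_with h G ->
  smooth_with (fun x => k * h x) (fun x => k *: G x).
Proof.
move=> [hG GL]; split => [x|i]; first exact: dgradZ.
by under eq_fun do rewrite mxE; exact: locally_lipschitzZ.
Qed.

Lemma smooth_with_sum (n : nat) (h : 'I_n -> 'rV[R]_d -> R) G :
  (forall j, smooth_with (h j) (G j)) ->
  smooth_with (fun x => \sum_j h j x) (fun x => \sum_j G j x).
Proof.
move=> hG; split => [x|i]; first by apply: dgrad_sum => j; exact: (hG j).1.
under eq_fun do rewrite summxE.
by apply: locally_lipschitz_sum => j; exact: (hG j).2.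
Qed.

Lemma smooth_with_dotp w : smooth_with (dotp w) (fun=> w).
Proof. by split => [x|i]; [exact: dgrad_dotp|exact: locally_lipschitz_cst]. Qed.

Lemma smooth_with_sq a : smooth_with (fun x => enorm (x - a) ^+ 2) (fun x => 2 *: (x - a)).
Proof.
split => [x|i]; first exact: dgrad_sq.
under eq_fun do rewrite !mxE; apply: locally_lipschitzZ; apply: locally_lipschitzD.
  exact: locally_lipschitz_coord.
exact: locally_lipschitz_cst.
Qed.

End locally_lipschitz.

Section smooth_loss.
Context {R : realType}.

(** What the argument uses about a single loss term, with the label y absorbed into [l]. *)
Record smooth_loss (c1 : R) (l dl : R -> R) : Prop := {
  smooth_loss_derive : forall s, is_derive s (1 : R) l (dl s) ;
  smooth_loss_tangent : forall s t, l s + dl s * (t - s) <= l t ;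
  smooth_loss_le1 : forall s, `|dl s| <= 1 ;
  smooth_loss_lipschitz : forall s t, `|dl s - dl t| <= c1 * `|s - t| }.

Context {c1 : R} {l dl : R -> R} (ldl : smooth_loss c1 l dl).

Lemma smooth_loss_monotone s t : 0 <= (dl s - dl t) * (s - t).
Proof. by have := smooth_loss_tangent _ _ _ ldl s t; have := smooth_loss_tangent _ _ _ ldl t s; lra. Qed.

Lemma smooth_loss_lipschitz1 s t : `|l s - l t| <= 1 * `|s - t|.
Proof.
have tangent s' t' : l s' - l t' <= `|s' - t'|.
  have := smooth_loss_tangent _ _ _ ldl s' t' => h.
  have : dl s' * (s' - t') <= `|s' - t'|.
    rewrite (le_trans (ler_norm _))// normrM -[leRHS]mul1r ler_wpM2r//.
    exact: smooth_loss_le1 ldl _.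
  lra.
have := tangent s t; have := tangent t s; rewrite (distrC t s) mul1r => h1 h2.
by rewrite ler_norml; apply/andP; split; lra.
Qed.

Lemma smooth_loss_convex {d : nat} (x : 'rV[R]_d) : strongly_convex 0 (fun f => l (dotp f x)).
Proof.
move=> f g t /andP[t0 t1]; rewrite !dotpE; set z := t * dotp f x + (1 - t) * dotp g x.
have h1 := ler_wpM2l t0 (smooth_loss_tangent _ _ _ ldl z (dotp f x)).
have t1' : 0 <= 1 - t by lra.
have h2 := ler_wpM2l t1' (smooth_loss_tangent _ _ _ ldl z (dotp g x)).
have E : t * (l z + dl z * (dotp f x - z)) + (1 - t) * (l z + dl z * (dotp g x - z)) = l z.
  by rewrite /z; ring.
by have := lerD h1 h2; rewrite E; lra.
Qed.

Lemma smooth_with_loss {d : nat} (x : 'rV[R]_d) : 0 <= c1 ->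
  smooth_with (fun f => l (dotp f x)) (fun f => dl (dotp f x) *: x).
Proof.
move=> c10; split => [f|i].
  by apply: dgrad_comp; exact: smooth_loss_derive ldl _.
under eq_fun do rewrite mxE mulrC; apply: locally_lipschitzZ.
by apply: locally_lipschitz_comp c10 _; exact: smooth_loss_lipschitz ldl.
Qed.

End smooth_loss.

Lemma smooth_loss_label {R : realType} (L : R -> R) (c1 y : R) :
  strictly_convex L -> C2_real L -> (forall x, `|derive1 L x| <= 1) ->
  (forall x, `|derive1 (derive1 L) x| <= c1) -> y = 1 \/ y = -1 ->
  smooth_loss c1 (fun s => L (y * s)) (fun s => y * derive1 L (y * s)).
Proof.
move=> cL [dL [ddL _]] L1 L2 y1.
have isdL (s : R) : is_derive s (1 : R) L (derive1 L s) by split => //; rewrite derive1E.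
have tangent (s t : R) : L s + derive1 L s * (t - s) <= L t.
  rewrite -lerBrDl; have [->|st] := eqVneq t s; first by rewrite !subrr mulr0.
  apply: (is_derive_slope_le (fun u => L (s + u * (t - s)))).
    apply: is_derive1_comp; first by rewrite mul0r addr0.
    by apply: is_derive_eq; rewrite !add0r mul1r scaler0 add0r [LHS]mulr1.
  move=> u /andP[u0 u1]; rewrite mul0r addr0.
  move: u1; rewrite le_eqVlt => /predU1P[->|u1].
    by rewrite !mul1r (addrC s) subrK.
  have := cL t s u st; rewrite u0 u1 => /(_ isT).
  by rewrite (_ : u * t + _ = s + u * (t - s)); [lra|ring].
have lip (s t : R) : `|derive1 L s - derive1 L t| <= c1 * `|s - t|.
  wlog st : s t / t <= s.
    move=> H; have [|/ltW] := leP t s; first exact: H.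
    by move=> /H; rewrite distrC (distrC t s).
  have [||u _ ->] := @MVT_segment R (derive1 L) (derive1 (derive1 L)) t s st.
  - by move=> u _; split => //; rewrite derive1E.
  - by apply: derivable_within_continuous => u _; exact: ddL.
  by rewrite normrM ler_wpM2r.
have yy : `|y| = 1 by case: y1 => ->; rewrite ?normrN normr1.
have y2 : y * y = 1 by case: y1 => ->; rewrite ?mulrNN mulr1.
split.
- move=> s; rewrite mulrC.
  have := @is_derive1_comp R L (fun s => y * s) s (derive1 L (y * s)) y; apply => //.
  by apply: is_derive_eq; rewrite ?scaler0 ?addr0 ?add0r [LHS]mulr1.
- by move=> s t; have := tangent (y * s) (y * t); rewrite -mulrBr; lra.
- by move=> s; rewrite normrM yy mul1r.
- move=> s t; rewrite -mulrBr normrM yy mul1r (le_trans (lip _ _))//.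
  by rewrite -mulrBr normrM yy mul1r.
Qed.

(** * Perturbed minimizers *)

Section perturbed_argmin.
Context {R : realType} {d : nat} {c m : R} (c0 : 0 < c) (m0 : 0 < m).
Implicit Types (J : 'rV[R]_d -> R) (e f x : 'rV[R]_d).

(** [e] is the noise and [J] the part of the objective that does not depend on it. *)
Definition perturbed_argmin J e : 'rV[R]_d := argmin (fun f => J f + c * dotp e f).

Definition regular_objective J := locally_lipschitz J /\ strongly_convex m J.

Let perturbed_convex J e : regular_objective J ->
  strongly_convex m (fun f => J f + c * dotp e f).
Proof.
move=> [_ cJ]; rewrite -[m]addr0; apply: strongly_convexD => //.
by rewrite -(mulr0 c); apply: strongly_convexZ (ltW c0) _; exact: strongly_convex_dotp.
Qed.

Lemma perturbed_argminP J e : regular_objective J ->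
  minimizes (fun f => J f + c * dotp e f) (perturbed_argmin J e).
Proof.
move=> rJ; apply: xgetPex; apply: strongly_convex_minimizer m0 (perturbed_convex _ e rJ) _.
apply: lipschitz_sup_ball_continuous; apply: locally_lipschitzD rJ.1 _.
by apply: locally_lipschitzZ; exact: locally_lipschitz_dotp.
Qed.

Lemma perturbed_argmin_eq J e f : regular_objective J ->
  minimizes (fun f => J f + c * dotp e f) f -> perturbed_argmin J e = f.
Proof.
move=> rJ; apply: minimizes_unique m0 (perturbed_convex _ e rJ) _.
exact: perturbed_argminP.
Qed.

(** Add the growth inequalities at the two minimizers, each tested at the other one; all terms in
    [J] cancel. *)
Lemma perturbed_argmin_antitone J e e' : regular_objective J ->
  c * dotp (e - e') (perturbed_argmin J e - perturbed_argmin J e') <=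
  - (m * enorm (perturbed_argmin J e - perturbed_argmin J e') ^+ 2).
Proof.
move=> rJ; set f := perturbed_argmin J e; set f' := perturbed_argmin J e'.
have h := minimizes_growth _ _ _ f' (ltW m0) (perturbed_convex _ e rJ) (perturbed_argminP _ e rJ).
have h' := minimizes_growth _ _ _ f (ltW m0) (perturbed_convex _ e' rJ) (perturbed_argminP _ e' rJ).
have := lerD h h'; rewrite -/f -/f' (enormB f' f) !dotpE; lra.
Qed.

Lemma perturbed_argmin_lipschitz J e e' : regular_objective J ->
  enorm (perturbed_argmin J e - perturbed_argmin J e') <= c / m * enorm (e - e').
Proof.
move=> rJ; have := perturbed_argmin_antitone _ e e' rJ.
set u := perturbed_argmin J e - perturbed_argmin J e' => h.
have := dotp_le_enorm (e - e') u; rewrite ler_norml => /andP[h1 _].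
have h2 : c * - (enorm (e - e') * enorm u) <= c * dotp (e - e') u by rewrite ler_pM2l.
have [->|u0] := eqVneq (enorm u) 0.
  by rewrite mulr_ge0 ?divr_ge0 ?enorm_ge0// ltW.
have {}u0 : 0 < enorm u by rewrite lt_neqAle eq_sym u0 enorm_ge0.
rewrite mulrAC ler_pdivlMr// -(ler_pM2r u0); lra.
Qed.

Lemma measurable_perturbed_argmin J : regular_objective J ->
  measurable_fun setT (perturbed_argmin J).
Proof.
move=> rJ; apply: measurable_fun_rVP => i; apply: (@lipschitz_measurable _ _ _ (c / m)).
  by rewrite divr_ge0// ltW.
move=> e e'; apply: le_trans (perturbed_argmin_lipschitz _ e e' rJ).
have := coord_le_enorm (perturbed_argmin J e - perturbed_argmin J e') i.
by rewrite !mxE.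
Qed.

Section add_loss.
Context {c1 : R} {l dl : R -> R} (c10 : 0 <= c1) (ldl : smooth_loss c1 l dl).
Context {J : 'rV[R]_d -> R} (rJ : regular_objective J) (x : 'rV[R]_d).

Definition add_loss f := J f + c * l (dotp f x).

Lemma regular_add_loss : regular_objective add_loss.
Proof.
case: rJ => JL Jm; split.
  apply: locally_lipschitzD => //; apply: locally_lipschitzZ.
  exact: locally_lipschitz_comp ler01 (smooth_loss_lipschitz1 ldl).
rewrite -[m]addr0; apply: strongly_convexD => //.
by have := strongly_convexZ _ _ _ (ltW c0) (smooth_loss_convex ldl x); rewrite mulr0.
Qed.

(** The maps U and U' of the overview. Each takes the gradient at the minimizer for its own argument
    e, which makes both maps explicit shears along [x]. *)
Definition add_loss_shift e := e + dl (dotp (perturbed_argmin add_loss e) x) *: x.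
Definition remove_loss_shift e := e + (- dl (dotp (perturbed_argmin J e) x)) *: x.

(* The stationary point of [add_loss] is also the one of [J] once the gradient
   of the extra loss at that point is put into the perturbation. *)
Lemma perturbed_argmin_add e :
  perturbed_argmin add_loss e = perturbed_argmin J (add_loss_shift e).
Proof.
set f := perturbed_argmin add_loss e; apply/esym/perturbed_argmin_eq => // g.
have := minimizes_linearize (fun f => J f + c * dotp e f)
  (fun f => c * l (dotp f x)) f (c *: (dl (dotp f x) *: x)).
have cJ : strongly_convex 0 (fun f => J f + c * dotp e f).
  move=> u v t t01; have := perturbed_convex _ e rJ u v t t01; rewrite mul0r !mul0r subr0.
  move=> /le_trans; apply; rewrite gerBl mulr_ge0 ?sqr_ge0//.
  by case/andP: t01 => t0 t1; rewrite !mulr_ge0 ?divr_ge0 ?subr_ge0// ltW.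
move=> /(_ cJ); have hd : dgrad (fun f => c * l (dotp f x)) f (c *: (dl (dotp f x) *: x)).
  by apply: dgradZ; apply: dgrad_comp; exact: smooth_loss_derive ldl _.
move=> /(_ hd) h.
have {h} := h _ g; rewrite /add_loss_shift -/f !dotpE => h.
have {h} : J f + c * dotp e f + c * (dl (dotp f x) * dotp x f) <=
    J g + c * dotp e g + c * (dl (dotp f x) * dotp x g).
  apply: h => g' /=; have := perturbed_argminP _ e regular_add_loss g'.
  by rewrite /add_loss -/f; lra.
lra.
Qed.

(** Adding the loss and subtracting its tangent at f changes the objective by a nonnegative function
    that vanishes at f, so f remains the minimizer. *)
Lemma perturbed_argmin_remove e :
  perturbed_argmin J e = perturbed_argmin add_loss (remove_loss_shift e).
Proof.
set f := perturbed_argmin J e; apply/esym/perturbed_argmin_eq; first exact: regular_add_loss.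
move=> g; have := perturbed_argminP _ e rJ g; rewrite -/f.
have := smooth_loss_tangent _ _ _ ldl (dotp f x) (dotp g x).
rewrite -(ler_pM2l c0) /remove_loss_shift /add_loss -/f !dotpE (dotpC x f) (dotpC x g).
lra.
Qed.

Let line_sq_le u : dotp u x ^+ 2 <= enorm u ^+ 2 * enorm x ^+ 2.
Proof. by rewrite !enorm_sq dotp_sq_le. Qed.

Context (x1 : enorm x <= 1).

Let dotp_x_sq u : dotp u x ^+ 2 <= enorm u ^+ 2.
Proof.
rewrite (le_trans (line_sq_le u))// ler_piMr ?sqr_ge0//.
by rewrite expr_le1// enorm_ge0.
Qed.

(** Antitonicity along [x], read off the scalar dot product with [x]; |x| <= 1 lets (u . x)^2
    replace |u|^2. *)
Let line_antitone J' e (k k' : R) : regular_objective J' ->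
  c * ((k - k') * (dotp (perturbed_argmin J' (e + k *: x)) x
                 - dotp (perturbed_argmin J' (e + k' *: x)) x)) <=
  - (m * (dotp (perturbed_argmin J' (e + k *: x)) x
        - dotp (perturbed_argmin J' (e + k' *: x)) x) ^+ 2).
Proof.
move=> rJ'; have := perturbed_argmin_antitone _ (e + k *: x) (e + k' *: x) rJ'.
set f := perturbed_argmin J' (e + k *: x); set f' := perturbed_argmin J' _ => /= h.
rewrite (_ : dotp f x - dotp f' x = dotp (f - f') x); last by rewrite !dotpE.
have E : dotp (e + k *: x - (e + k' *: x)) (f - f') = (k - k') * dotp (f - f') x.
  by rewrite -(dotpC x) -dotpZl; congr dotp; apply/rowP => i; rewrite !mxE; ring.
by rewrite E in h; apply: (le_trans h); rewrite lerN2 ler_pM2l.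
Qed.

Context {Leb : {measure set 'rV[R]_d -> \bar R}} (hL : is_lebesgue_rV Leb).

Let measurable_dl : measurable_fun setT dl.
Proof.
apply: continuous_measurable_fun => s; apply/(@cvgrPdist_lt _ R^o) => e e0.
have D0 : 0 < e / (c1 + 1) by rewrite divr_gt0// ltr_wpDl.
near=> t; rewrite (le_lt_trans (smooth_loss_lipschitz _ _ _ ldl _ _))//.
have : `|s - t| < e / (c1 + 1) by near: t; exact: (nbhs_ball_norm s (PosNum D0)).
rewrite ltr_pdivlMr ?ltr_wpDl//; have := normr_ge0 (s - t); lra.
Unshelve. all: by end_near. Qed.

Let measurable_dotp_x F : measurable_fun setT F ->
  measurable_fun setT (fun e : 'rV[R]_d => dotp (F e : 'rV[R]_d) x).
Proof.
move=> mF; rewrite /dotp; apply: measurable_sum => i.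
apply: measurable_funM => //.
exact: measurableT_comp (measurable_coord i) mF.
Qed.

Lemma measurable_add_loss_gradient :
  measurable_fun setT (fun e => dl (dotp (perturbed_argmin add_loss e) x)).
Proof.
apply: measurableT_comp measurable_dl _; apply: measurable_dotp_x.
by apply: measurable_perturbed_argmin; exact: regular_add_loss.
Qed.

Lemma measurable_remove_loss_gradient :
  measurable_fun setT (fun e => - dl (dotp (perturbed_argmin J e) x)).
Proof.
apply: measurableT_comp => //; apply: measurableT_comp measurable_dl _.
by apply: measurable_dotp_x; exact: measurable_perturbed_argmin.
Qed.

(** Let k = s + dl a be the shifted parameter. The minimizer of [add_loss] at s is that of [J] at k,
    so antitonicity of the latter gives m |a - b| <= c |k - k'|. As s - s' = (k - k') - (dl a - dl
    b), the Lipschitz bound on [dl] yields the factor 1 + c1 c / m. *)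
Lemma lebesgue_add_loss_shift A : measurable A ->
  (Leb (add_loss_shift @^-1` A) <= (1 + c1 * c / m)%:E * Leb A)%E.
Proof.
move=> mA; apply: (lebesgue_rV_shear _ hL x _ _ 1) => //.
- by rewrite ltr_wpDr// mulr_ge0 ?invr_ge0 ?mulr_ge0// ltW.
- exact: measurable_add_loss_gradient.
- by move=> e; exact: smooth_loss_le1 ldl _.
move=> e s s'.
have shiftE t : add_loss_shift (e + t *: x) =
    e + (t + dl (dotp (perturbed_argmin add_loss (e + t *: x)) x)) *: x.
  by rewrite /add_loss_shift -addrA -scalerDl.
set k := s + dl _; set k' := s' + dl _.
have := line_antitone J e k k' rJ.
rewrite /k /k' -!shiftE -!perturbed_argmin_add -/k -/k'.
set a := dotp (perturbed_argmin add_loss (e + s *: x)) x.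
set b := dotp (perturbed_argmin add_loss (e + s' *: x)) x => h.
have z : m * `|a - b| <= c * `|k - k'|.
  have [->|ab] := eqVneq (a - b) 0; first by rewrite normr0 mulr0 mulr_ge0 ?normr_ge0 ?ltW.
  have ab0 : 0 < `|a - b| by rewrite normr_gt0.
  rewrite -(ler_pM2r ab0) -!mulrA -expr2 real_normK ?num_real// -normrM.
  have := ler_norm (- ((k - k') * (a - b))); rewrite normrN => h'.
  have := ler_wpM2l (ltW c0) h'; lra.
have := smooth_loss_lipschitz _ _ _ ldl a b => h1.
have -> : s - s' = (k - k') - (dl a - dl b) by rewrite /k /k'; ring.
rewrite (le_trans (ler_normB _ _))// mulrDl mul1r lerD2l (le_trans h1)//.
by rewrite -!mulrA ler_wpM2l// mulrA mulrAC ler_pdivlMr// mulrC.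
Qed.

(** Here a is nonincreasing in s and [dl] is nondecreasing, so s - dl a expands distances and the
    factor is 1. *)
Lemma lebesgue_remove_loss_shift A : measurable A ->
  (Leb (remove_loss_shift @^-1` A) <= Leb A)%E.
Proof.
move=> mA; rewrite -[leRHS]mul1e; apply: (lebesgue_rV_shear _ hL x _ _ 1) => //.
- exact: measurable_remove_loss_gradient.
- by move=> e; rewrite normrN; exact: smooth_loss_le1 ldl _.
move=> e s s'; have := line_antitone J e s s' rJ.
set a := dotp (perturbed_argmin J (e + s *: x)) x.
set b := dotp (perturbed_argmin J (e + s' *: x)) x => h.
have mono := smooth_loss_monotone ldl a b; rewrite mul1r.
have mz : 0 <= m * (a - b) ^+ 2 by rewrite mulr_ge0 ?sqr_ge0// ltW.
have sz : (s - s') * (a - b) <= 0.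
  by rewrite -(ler_pM2l c0) mulr0 (le_trans h)// oppr_le0.
(* In the square of (s - s') - (dl a - dl b) the cross term is nonnegative. *)
rewrite -ler_sqr ?nnegrE// !real_normK ?num_real//.
have : (s - s') * (dl a - dl b) <= 0.
  have [ab|ab|->] := ltgtP a b; last by rewrite subrr mulr0.
    move: ab sz mono; rewrite -subr_lt0 => ab; rewrite nmulr_lle0// nmulr_lge0//.
    exact: mulr_ge0_le0.
  move: ab sz mono; rewrite -subr_gt0 => ab; rewrite pmulr_lle0// pmulr_lge0//.
  exact: mulr_le0_ge0.
have := sqr_ge0 (dl a - dl b); lra.
Qed.

End add_loss.
End perturbed_argmin.

(** * Densities *)

Section densities.
Context {d1 d2 : measure_display} {T1 : measurableType d1} {T2 : measurableType d2}.
Context {R : realType}.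
Local Open Scope ereal_scope.

(** The law of [F] under the density [n] is a finite measure, and the last hypothesis is its
    absolute continuity. *)
Lemma image_density (mu : {measure set T1 -> \bar R})
    (nu : {sigma_finite_measure set T2 -> \bar R}) (F : T1 -> T2) (n : T1 -> R) :
  measurable_fun setT F -> measurable_fun setT n -> (forall x, 0 <= n x)%R ->
  \int[mu]_x (n x)%:E < +oo ->
  (forall N, measurable N -> nu N = 0 -> mu (F @^-1` N) = 0) ->
  exists q : T2 -> R, [/\ forall y, (0 <= q y)%R, measurable_fun setT q &
    forall A, measurable A -> \int[mu]_(x in F @^-1` A) (n x)%:E = \int[nu]_(y in A) (q y)%:E].
Proof.
move=> mF mn n0 nfin dom.
have mFA A : measurable A -> measurable (F @^-1` A).
  by move=> mA; rewrite -[X in measurable X]setTI; exact: mF.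
have mnE D : measurable_fun D (EFin \o n).
  by apply: measurable_funTS; exact/measurable_EFinP.
have nE0 D x : D x -> 0 <= (n x)%:E by move=> _; rewrite lee_fin.
pose Q (A : set T2) : \bar R := \int[mu]_(x in F @^-1` A) (n x)%:E.
have Q0 : Q set0 = 0 by rewrite /Q preimage_set0 integral_set0.
have Q_ge0 A : 0 <= Q A by apply: integral_ge0 => x; exact: nE0.
have Qsigma : semi_sigma_additive Q.
  move=> /= G mG tG mUG; rewrite /Q; apply: cvg_toP.
    apply: ereal_nondecreasing_is_cvgn => i j ij.
    apply: lee_sum_nneg_natr => // k _ _; exact: Q_ge0.
  rewrite preimage_bigcup ge0_integral_bigcup//.
  - by move=> k; exact: mFA.
  - exact: nE0.
  - by apply/trivIsetP => i j _ _ ij; rewrite -preimage_setI;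
      have /trivIsetP -> := tG; rewrite ?preimage_set0.
have Qfin : fin_num_fun Q.
  move=> A mA; rewrite ge0_fin_numE// (le_lt_trans _ nfin)//.
  by apply: ge0_subset_integral => //; [exact: mFA|exact: nE0].
pose HQ := isMeasure.Build _ _ _ Q Q0 Q_ge0 Qsigma.
pose Qm : {measure set T2 -> \bar R} := HB.pack Q HQ.
have Qsf : sigma_finite setT Q by apply: fin_num_fun_sigma_finite => //; rewrite Q0.
pose H1 := isFinite.Build _ _ _ (Measure.sort Qm) Qfin.
pose H2 := isSFinite.Build _ _ _ (Measure.sort Qm) (@sfinite_measure_sigma_finite _ _ _ Qm Qsf).
pose H3 := isSigmaFinite.Build _ _ _ (Measure.sort Qm) Qsf.
pose Qf := HB.pack_for (FiniteMeasure.type T2 R) (Measure.sort Qm) H1 H2 H3.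
have Qdom : Qf `<< nu.
  apply/null_content_dominatesP => N mN N0.
  by apply: null_set_integral => //; [exact: mFA|exact: dom].
have [f [f0 ffin fint fQ]] := radon_nikodym_sigma_finite Qdom.
exists (fine \o f); split.
- by move=> y; exact: fine_ge0.
- by apply: measurableT_comp => //; have /integrableP[] := fint.
- move=> A mA; rewrite -[LHS]/(Qf A) fQ//; apply: eq_integral => y _.
  by rewrite /= fineK.
Qed.

(** Truncation of [q] at k q' keeps the measure: where k q' < q the integral of k q' is at most that
    of q pointwise, and at least that by hypothesis. The truncated density satisfies the bound at
    every point. *)
Lemma integral_min_density (nu : {measure set T2 -> \bar R}) (q q' : T2 -> R) (k : R) :
  (0 <= k)%R -> (forall y, 0 <= q y)%R -> (forall y, 0 <= q' y)%R ->
  measurable_fun setT q -> measurable_fun setT q' ->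
  (forall A, measurable A ->
    \int[nu]_(y in A) (q y)%:E <= k%:E * \int[nu]_(y in A) (q' y)%:E) ->
  forall A, measurable A ->
    \int[nu]_(y in A) (Num.min (q y) (k * q' y))%:E = \int[nu]_(y in A) (q y)%:E.
Proof.
move=> k0 q0 q'0 mq mq' qq' A mA.
pose B := [set y | (k * q' y < q y)%R].
have mkq' : measurable_fun setT (fun y => k * q' y)%R by exact: measurable_funM.
have mB : measurable B.
  rewrite -[B]setTI.
  by have := measurable_fun_ltr mkq' mq measurableT (Y := [set true]); apply.
have mE (g : T2 -> R) D : measurable_fun setT g ->
    measurable_fun D (fun y => (g y)%:E).
  by move=> mg; apply: measurable_funTS; exact/measurable_EFinP.
have mmin : measurable_fun setT (fun y => Num.min (q y) (k * q' y))%R.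
  exact: measurable_minr.
have mAB : measurable (A `&` B) by exact: measurableI.
have mADB : measurable (A `\` B) by exact: measurableD.
have disj : [disjoint A `&` B & A `\` B].
  by apply/disj_set2P/seteqP; split => // y [[_ By] [_]].
rewrite -[in LHS](setUIDK A B) -[in RHS](setUIDK A B).
rewrite !ge0_integral_setU//; last 4 first.
- exact: mE.
- by move=> y _; rewrite lee_fin.
- exact: mE.
- by move=> y _; rewrite lee_fin le_min q0 mulr_ge0.
congr (_ + _); last first.
  apply: eq_integral => y /set_mem[_ /negP]; rewrite -leNgt => qk.
  by rewrite min_l.
transitivity (\int[nu]_(y in A `&` B) (k%:E * (q' y)%:E)).
  by apply: eq_integral => y /set_mem[_ kq]; rewrite min_r// ltW.
apply/eqP; rewrite eq_le; apply/andP; split.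
  apply: ge0_le_integral => //.
  - by move=> y _; rewrite -EFinM lee_fin mulr_ge0.
  - exact: (mE (fun y => k * q' y)%R).
  - exact: mE.
  - by move=> y [_ /ltW]; rewrite -EFinM lee_fin.
rewrite (le_trans (qq' _ mAB))// ge0_integralZl//.
- exact: mE.
- by move=> y _; rewrite lee_fin.
Qed.

End densities.

(** * Recovering the noise from the minimizer *)

Section stationarity.
Context {R : realType} {d : nat} {c m rho : R} {Reg S J : 'rV[R]_d -> R}.
Context {G : 'rV[R]_d -> 'rV[R]_d}.
Hypotheses (c0 : 0 < c) (m0 : 0 < m) (rho0 : 0 <= rho).
Hypotheses (C2Reg : C2_rV Reg) (cReg : strongly_convex 0 Reg) (SG : smooth_with S G).
Hypotheses (JE : J = fun f => rho * Reg f + S f) (rJ : @regular_objective R d m J).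

(** [C2_rV] gives [Reg] only partial derivatives, so [Reg] is kept as the convex part while [S] and
    the noise are linearized; then the function of one variable along each basis vector is
    differentiated at its minimum. *)
Lemma perturbed_argmin_stationary e (i : 'I_d) :
  let f := @perturbed_argmin R d c J e in
  rho * 'D_(ebasis i) Reg f + G f ord0 i + c * e ord0 i = 0.
Proof.
move=> f.
have fmin : minimizes (fun g => rho * Reg g + dotp (G f + c *: e) g) f.
  apply: (minimizes_linearize _ (fun g => S g + c * dotp e g)).
  - by have := strongly_convexZ _ _ _ rho0 cReg; rewrite mulr0.
  - by apply: dgradD; [exact: SG.1|apply: dgradZ; exact: dgrad_dotp].
  - move=> g /=; rewrite !addrA; have Jp h : rho * Reg h + S h = J h by rewrite JE.
    by rewrite !Jp; exact: (perturbed_argminP c0 m0 _ e rJ).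
set w := G f + c *: e in fmin.
pose phi (t : R) := rho * Reg (f + t *: ebasis i) + (dotp w f + t * dotp w (ebasis i)).
have dphi (t : R) :
    is_derive t 1 phi (rho * 'D_(ebasis i) Reg (f + t *: ebasis i) + dotp w (ebasis i)).
  apply: is_deriveD.
    by apply: is_deriveZ; apply: is_derive_line; exact: C2Reg.1.
  by apply: is_derive_eq; rewrite !add0r mul1r scaler0 add0r [LHS]mulr1.
have phi0 : is_derive (0 : R) 1 phi 0.
  apply: (@derive1_at_min R phi (-1) 1); first lra.
  - by move=> t _; have [] := dphi t.
  - by rewrite in_itv/=; apply/andP; split; lra.
  - move=> t _; have := fmin (f + t *: ebasis i).
    by rewrite /phi scale0r addr0 !dotpE; lra.
have [_ d1] := dphi 0; have [_ d2] := phi0.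
move: d2; rewrite d1 scale0r addr0 dotp_basis /w !mxE; lra.
Qed.

(** Stationarity expresses c e_i through the minimizer, by partial derivatives of [Reg] and
    coordinates of [G], all locally Lipschitz. *)
Lemma perturbed_argmin_colipschitz (r : nat) :
  let F := @perturbed_argmin R d c J in
  exists2 L : R, 0 < L & forall e e' D, cube r%:R (F e) -> cube r%:R (F e') ->
     (forall i, `|F e ord0 i - F e' ord0 i| <= D) ->
     forall i, `|e ord0 i - e' ord0 i| <= L * D.
Proof.
move=> F.
have GL i : locally_lipschitz (fun f => rho * 'D_(ebasis i) Reg f + G f ord0 i).
  apply: locally_lipschitzD (SG.2 i); apply: locally_lipschitzZ => r'.
  have [_ [_ [dd cd]]] := C2Reg.
  by apply: C1_lipschitz => [j x|j]; [exact: dd|exact: cd].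
have /choice[L hL] : forall i : 'I_d, exists L : R, 0 <= L /\
    forall x y, sup_ball r%:R x -> sup_ball r%:R y ->
    `|(rho * 'D_(ebasis i) Reg x + G x ord0 i) - (rho * 'D_(ebasis i) Reg y + G y ord0 i)| <=
    L * enorm (x - y).
  by move=> i; have [L L0 h] := GL i r%:R; exists L.
have L0 i : 0 <= L i := (hL i).1.
have SL : 0 <= (\sum_i L i) * d%:R / c.
  by rewrite mulr_ge0 ?invr_ge0 ?(ltW c0)// mulr_ge0// sumr_ge0.
(* The 1 only ensures a positive constant. *)
exists ((\sum_i L i) * d%:R / c + 1); first by rewrite ltr_wpDl.
move=> e e' D re re' FD i.
have ball x : cube r%:R x -> sup_ball r%:R (x : 'rV[R]_d).
  move=> /cubeP rx j; have /andP[h1 h2] := rx j.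
  by rewrite ler_norml h2 ltW.
have D0 : 0 <= D := le_trans (normr_ge0 _) (FD i).
have := (hL i).2 _ _ (ball _ re) (ball _ re').
have := perturbed_argmin_stationary e i; have := perturbed_argmin_stationary e' i.
rewrite -/F /= => s' s.
have -> : rho * 'D_(ebasis i) Reg (F e) + G (F e) ord0 i -
   (rho * 'D_(ebasis i) Reg (F e') + G (F e') ord0 i) = - (c * (e ord0 i - e' ord0 i)) by lra.
rewrite normrN normrM gtr0_norm// => h.
have nD : enorm (F e - F e') <= d%:R * D.
  rewrite (le_trans (enorm_le_sum _))// mulr_natl.
  rewrite [leRHS](_ : _ = \sum_(j < d) D); last by rewrite sumr_const card_ord.
  by apply: ler_sum => j _; have := FD j; rewrite !mxE.
have Li : L i <= \sum_i L i by rewrite (bigD1 i)//= lerDl sumr_ge0.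
have h' : c * `|e ord0 i - e' ord0 i| <= (\sum_i L i) * (d%:R * D).
  rewrite (le_trans h)// (le_trans (ler_wpM2l (L0 i) nD))// ler_wpM2r//.
  by rewrite mulr_ge0.
rewrite mulrDl mul1r ler_wpDr// mulrAC ler_pdivlMr// mulrC -mulrA.
exact: h'.
Qed.

End stationarity.

(** * The exponential noise *)

Section noise.
Context {R : realType} {d : nat} (Leb : {measure set 'rV[R]_d -> \bar R}) (a : R).
Hypothesis a0 : 0 <= a.

Let noise := noise_density Leb a.

Let I := (\int[Leb]_z (expR (- (a / 2) * enorm z))%:E)%E.

Let I_ge0 : (0 <= I)%E.
Proof. by apply: integral_ge0 => z _; rewrite lee_fin expR_ge0. Qed.

Lemma noise_density_ge0 e : 0 <= noise e.
Proof. by rewrite /noise /noise_density mulr_ge0 ?expR_ge0// invr_ge0 fine_ge0. Qed.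

Let measurable_expR_enorm :
  measurable_fun setT (fun z : 'rV[R]_d => expR (- (a / 2) * enorm z)).
Proof.
apply: measurableT_comp => //; apply: measurable_funM => //.
exact: measurable_enorm.
Qed.

Lemma measurable_noise_density : measurable_fun setT noise.
Proof. exact: measurable_funM. Qed.

(* If the normalization were infinite, [fine] would make it [0] and the density
   would vanish, so no integrability of the exponential is needed. *)
Lemma integral_noise_density_lty : (\int[Leb]_e (noise e)%:E < +oo)%E.
Proof.
rewrite /noise /noise_density -/I.
under eq_integral do rewrite EFinM.
rewrite ge0_integralZr//; last 2 first.
- exact/measurable_EFinP.
- by rewrite lee_fin invr_ge0 fine_ge0.
rewrite -/I; case: I I_ge0 => [r|//|//] _ /=; last by rewrite invr0 mule0.
by rewrite -EFinM ltry.
Qed.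

Lemma noise_density_shift e e' : enorm e' <= enorm e + 2 ->
  noise e <= expR a * noise e'.
Proof.
move=> ee'; rewrite /noise /noise_density mulrA ler_wpM2r//.
  by rewrite invr_ge0 fine_ge0.
rewrite -expRD ler_expR.
have : a / 2 * enorm e' <= a / 2 * (enorm e + 2) by rewrite ler_wpM2l// divr_ge0.
lra.
Qed.

(** First noise e <= e^a noise (V e); then the integral of noise o V is an integral against the
    pushforward of [Leb] by [V], a measure bounded by K [Leb]. *)
Lemma noise_law_le (V F' : 'rV[R]_d -> 'rV[R]_d) (K : R) A : 0 <= K ->
  measurable_fun setT V -> measurable_fun setT F' ->
  (forall e, enorm (V e) <= enorm e + 2) ->
  (forall B, measurable B -> (Leb (V @^-1` B) <= K%:E * Leb B)%E) -> measurable A ->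
  (\int[Leb]_(e in (F' \o V) @^-1` A) (noise e)%:E <=
   (expR a * K)%:E * \int[Leb]_(e in F' @^-1` A) (noise e)%:E)%E.
Proof.
move=> K0 mV mF' Vle VK mA.
have mD : measurable (F' @^-1` A) by rewrite -[X in measurable X]setTI; exact: mF'.
have mVD : measurable (V @^-1` (F' @^-1` A)).
  by rewrite -[X in measurable X]setTI; exact: mV.
have mnoise D : measurable_fun D (fun e => (noise e)%:E).
  by apply: measurable_funTS; apply/measurable_EFinP; exact: measurable_noise_density.
have mnoiseV D : measurable_fun D (fun e => (noise (V e))%:E).
  apply: measurable_funTS; apply/measurable_EFinP.
  exact: measurableT_comp measurable_noise_density mV.
apply: (@le_trans _ _ (\int[Leb]_(e in V @^-1` (F' @^-1` A)) ((expR a)%:E * (noise (V e))%:E))%E).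
  apply: ge0_le_integral => //.
  - by move=> e _; rewrite lee_fin noise_density_ge0.
  - by apply: measurable_funeM; exact: (mnoiseV _).
  - by move=> e _; rewrite -EFinM lee_fin noise_density_shift.
have nV_ge0 e : (V @^-1` (F' @^-1` A)) e -> (0 <= (noise (V e))%:E)%E.
  by move=> _; rewrite lee_fin noise_density_ge0.
have a_ge0 : (0 <= (expR a)%:E)%E by rewrite lee_fin expR_ge0.
rewrite (ge0_integralZl Leb mVD (mnoiseV _) nV_ge0 a_ge0).
rewrite EFinM -muleA lee_wpmul2l ?lee_fin ?expR_ge0//.
have -> : (\int[Leb]_(e in V @^-1` (F' @^-1` A)) (noise (V e))%:E =
    \int[pushforward Leb V]_(e in F' @^-1` A) (noise e)%:E)%E.
  by rewrite (ge0_integral_pushforward mV)// => e _; rewrite lee_fin noise_density_ge0.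
have -> : (K%:E * \int[Leb]_(e in F' @^-1` A) (noise e)%:E =
    \int[mscale (NngNum K0) Leb]_(e in F' @^-1` A) (noise e)%:E)%E.
  by rewrite ge0_integral_mscale// => e _; rewrite lee_fin noise_density_ge0.
pose mfV : {mfun 'rV[R]_d >-> 'rV[R]_d} := HB.pack V (isMeasurableFun.Build _ _ _ _ _ mV).
apply: (@ge0_le_measure_integral _ _ _ (pushforward Leb mfV)) => //.
by move=> e; rewrite lee_fin noise_density_ge0.
Qed.

End noise.

(** * The dual variable perturbation step *)

Lemma shift_le {R : realType} {d : nat} (u x : 'rV[R]_d) (s : R) :
  `|s| <= 1 -> enorm x <= 1 -> enorm (u + s *: x) <= enorm u + 1.
Proof.
move=> s1 x1; rewrite (le_trans (enormD _ _))// lerD2l enormZ.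
by rewrite mulr_ile1// enorm_ge0.
Qed.

(** In the first branch K = 1 + z and a = alpha - 2 ln K, so a + ln K = alpha - ln K. In the second,
    m becomes c1 CR / (Bp (e^(alpha/4) - 1)), so K = e^(alpha/4) and the total exponent is 3 alpha /
    4. *)
Lemma privacy_budget {R : realType} (c1 CR rho eta alpha : R) (Bp Np : nat) :
  (1 <= Bp)%N -> 0 < c1 -> 0 < CR -> 0 < rho -> 0 < eta -> 0 < alpha ->
  let m := rho + Phi_param c1 CR rho eta alpha Bp Np + 2 * eta * Np%:R in
  let a := alpha_hat c1 CR rho eta alpha Bp Np in
  [/\ 0 < m, 0 <= a & expR a * (1 + c1 * (CR / Bp%:R) / m) <= expR alpha].
Proof.
move=> B1 c10 CR0 rho0 eta0 alpha0 m a.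
have B0 : 0 < Bp%:R :> R by rewrite ltr0n.
have M0 : 0 < rho + 2 * eta * Np%:R by rewrite ltr_pwDl// !mulr_ge0// ltW.
rewrite {}/m {}/a /Phi_param /alpha_hat; case: ifPn => [a0|_].
  rewrite addr0; split=> //; first exact: ltW.
  rewrite (_ : c1 * (CR / Bp%:R) / (rho + 2 * eta * Np%:R) =
      c1 * CR / (Bp%:R * (rho + 2 * eta * Np%:R))); last by field; rewrite !gt_eqF.
  rewrite /alpha_hat0; set z := c1 * CR / _.
  have z0 : 0 <= z by rewrite divr_ge0// mulr_ge0// ltW.
  have z1 : 0 < 1 + z by lra.
  rewrite -[X in _ * X <= _](lnK z1) -expRD ler_expR.
  have := @ln_ge0 R (1 + z); rewrite lerDl => /(_ z0); lra.
have E1 : 0 < expR (alpha / 4) - 1 by rewrite subr_gt0 expR_gt1 divr_gt0.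
set M := c1 * CR / _.
have M1 : 0 < M by rewrite divr_gt0 ?mulr_gt0.
rewrite (_ : rho + (M - rho - 2 * eta * Np%:R) + 2 * eta * Np%:R = M); last by ring.
split=> //; first by rewrite divr_ge0// ltW.
rewrite (_ : 1 + c1 * (CR / Bp%:R) / M = expR (alpha / 4)).
  by rewrite -expRD ler_expR; lra.
by rewrite /M; field; rewrite !gt_eqF.
Qed.

Section objective_decomposition.
Context {R : realType} {d Bp Np : nat} (Loss : R -> R) (Reg : 'rV[R]_d -> R).
Context (c1 CR rho eta alpha : R) (lam fp : 'rV[R]_d) (fN : 'I_Np -> 'rV[R]_d).
Context (k : 'I_Bp).
Hypotheses (B1 : (1 <= Bp)%N) (c10 : 0 < c1) (CR0 : 0 < CR) (rho0 : 0 < rho).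
Hypotheses (cL : strictly_convex Loss) (C2L : C2_real Loss).
Hypotheses (L1 : forall x, `|derive1 Loss x| <= 1).
Hypotheses (L2 : forall x, `|derive1 (derive1 Loss) x| <= c1).
Hypotheses (C2Reg : C2_rV Reg) (cReg : strongly_convex1 Reg).

Let c := CR / Bp%:R.
Let Phi := Phi_param c1 CR rho eta alpha Bp Np.
Let m := rho + Phi + 2 * eta * Np%:R.

(** The weight [(j != k)%:R] drops the exchanged point without changing the index set; [f - 0] gives
    the regularizing square the same shape as the consensus terms. *)
Definition smooth_part (X : 'I_Bp -> 'rV[R]_d) (Y : 'I_Bp -> R) (f : 'rV[R]_d) : R :=
  \sum_j ((j != k)%:R * c) * Loss (Y j * dotp f (X j)) + (2 * dotp lam f +
  (Phi / 2 * enorm (f - 0) ^+ 2 + \sum_i eta * enorm (f - 2^-1 *: (fp + fN i)) ^+ 2)).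

Definition base_objective X Y f := rho * Reg f + smooth_part X Y f.

Let c0 : 0 < c. Proof. by rewrite divr_gt0// ltr0n. Qed.

Let w0 (j : 'I_Bp) : 0 <= (j != k)%:R * c.
Proof. by rewrite mulr_ge0// ltW. Qed.

Let lossP y : y = 1 \/ y = -1 ->
  smooth_loss c1 (fun s => Loss (y * s)) (fun s => y * derive1 Loss (y * s)).
Proof. exact: smooth_loss_label. Qed.

Lemma smooth_partP X Y : valid_data X Y -> exists G, smooth_with (smooth_part X Y) G.
Proof.
move=> vD; exists (fun f => \sum_j ((j != k)%:R * c) *:
    ((Y j * derive1 Loss (Y j * dotp f (X j))) *: X j) + (2 *: lam +
  (Phi / 2 *: (2 *: (f - 0)) + \sum_i eta *: (2 *: (f - 2^-1 *: (fp + fN i)))))).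
apply: smooth_withD.
  apply: smooth_with_sum => j; apply: smooth_withZ.
  exact: (smooth_with_loss (lossP _ (vD j).2) (X j) (ltW c10)).
apply: smooth_withD; first by apply: smooth_withZ; exact: smooth_with_dotp.
apply: smooth_withD; first by apply: smooth_withZ; exact: smooth_with_sq.
by apply: smooth_with_sum => i; apply: smooth_withZ; exact: smooth_with_sq.
Qed.

Let strongly_convex_Reg : strongly_convex 1 Reg.
Proof. by move=> x y t t01; have := cReg x y t t01; rewrite mul1r. Qed.

Lemma strongly_convex0_Reg : strongly_convex 0 Reg.
Proof.
move=> x y t t01; have := cReg x y t t01; move/le_trans; apply.
rewrite lerD2l lerN2 !mul0r mulr_ge0 ?sqr_ge0//.
by case/andP: t01 => t0 t1; rewrite !mulr_ge0// subr_ge0.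
Qed.

Lemma regular_base_objective X Y : valid_data X Y ->
  @regular_objective R d m (base_objective X Y).
Proof.
move=> vD; split.
  apply: locally_lipschitzD.
    apply: locally_lipschitzZ => r; have [dR [cR _]] := C2Reg.
    exact: C1_lipschitz.
  apply: locally_lipschitzD.
    apply: locally_lipschitz_sum => j; apply: locally_lipschitzZ.
    exact: (locally_lipschitz_comp _ _ (X j) ler01 (smooth_loss_lipschitz1 (lossP _ (vD j).2))).
  apply: locally_lipschitzD.
    by apply: locally_lipschitzZ; exact: locally_lipschitz_dotp.
  apply: locally_lipschitzD; first by apply: locally_lipschitzZ; exact: locally_lipschitz_sq.
  by apply: locally_lipschitz_sum => i; apply: locally_lipschitzZ; exact: locally_lipschitz_sq.
have -> : m = rho * 1 + (\sum_(j < Bp) ((j != k)%:R * c) * 0 +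
    (2 * 0 + (2 * (Phi / 2) + \sum_(i < Np) 2 * eta))).
  rewrite sumr_const card_ord -mulr_natr big1; last by move=> j _; rewrite mulr0.
  by rewrite /m; field.
apply: strongly_convexD; first exact: strongly_convexZ (ltW rho0) strongly_convex_Reg.
apply: strongly_convexD.
  apply: strongly_convex_sum => j; apply: strongly_convexZ (w0 j) _.
  exact: (smooth_loss_convex (lossP _ (vD j).2) (X j)).
apply: strongly_convexD.
  by apply: strongly_convexZ => //; exact: strongly_convex_dotp.
apply: strongly_convexD; first exact: strongly_convex_sq.
by apply: strongly_convex_sum => i; exact: strongly_convex_sq.
Qed.

Lemma outputE X Y :
  output Loss Reg c1 CR rho eta alpha lam fp fN X Y =
  @perturbed_argmin R d c
    (add_loss (c := c) (l := fun s => Loss (Y k * s)) (J := base_objective X Y) (X k)).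
Proof.
apply/funext => e; rewrite /output /perturbed_argmin; congr argmin; apply/funext => f.
have B0 : Bp%:R != 0 :> R by rewrite pnatr_eq0 -lt0n.
rewrite /add_loss.
have -> : c * Loss (Y k * dotp f (X k)) =
    \sum_j ((j == k)%:R * c) * Loss (Y j * dotp f (X j)).
  rewrite (bigD1 k)//= eqxx mul1r big1 ?addr0// => j /negbTE ->.
  by rewrite !mul0r.
rewrite /objective /base_objective /smooth_part -/Phi subr0 -mulr_sumr.
have -> : CR / Bp%:R * (\sum_(j < Bp) Loss (Y j * dotp f (X j))) =
    \sum_j ((j != k)%:R * c) * Loss (Y j * dotp f (X j)) +
    \sum_j ((j == k)%:R * c) * Loss (Y j * dotp f (X j)).
  rewrite mulr_sumr -big_split /=; apply: eq_bigr => j _.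
  by rewrite -/c; case: eqP => _; rewrite /= !(mul0r, mul1r) ?add0r ?addr0.
(* The factor 2 before mu cancels the 2 in CR / (2 Bp), leaving the weight c on the noise. *)
rewrite !dotpE (_ : 2 * (dotp lam f + CR / (2 * Bp%:R) * dotp e f) =
  2 * dotp lam f + c * dotp e f); first by ring.
by rewrite /c; field.
Qed.

(** Neighboring datasets share the objective without the exchanged point, through which the two
    outputs are compared. *)
Lemma base_objective_ext X Y X' Y' :
  (forall j, j != k -> (X j, Y j) = (X' j, Y' j)) -> base_objective X Y = base_objective X' Y'.
Proof.
move=> kD; apply/funext => f; rewrite /base_objective /smooth_part.
congr (_ + (_ + _)); apply: eq_bigr => j _.
by have [//|jk] := eqVneq j k; [rewrite !mul0r|have [-> ->] := kD j jk].
Qed.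

End objective_decomposition.

Theorem theorem1 (R : realType) (d Bp Np : nat)
  (Leb : {measure set 'rV[R]_d -> \bar R})
  (Loss : R -> R) (Reg : 'rV[R]_d -> R) (c1 CR rho eta alpha : R)
  (lam fp : 'rV[R]_d) (fN : 'I_Np -> 'rV[R]_d)
  (X : 'I_Bp -> 'rV[R]_d) (Y : 'I_Bp -> R)
  (X' : 'I_Bp -> 'rV[R]_d) (Y' : 'I_Bp -> R) :
  is_lebesgue_rV Leb ->
  (1 <= d)%N -> (1 <= Bp)%N -> (1 <= Np)%N ->
  0 < c1 -> 0 < CR -> 0 < rho -> 0 < eta -> 0 < alpha ->
  strictly_convex Loss -> C2_real Loss ->
  (forall x, `|derive1 Loss x| <= 1) -> (forall x, `|derive1 (derive1 Loss) x| <= c1) ->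
  C2_rV Reg -> strongly_convex1 Reg ->
  valid_data X Y -> valid_data X' Y' -> neighboring X Y X' Y' ->
  exists q q' : 'rV[R]_d -> R,
    is_density Leb (output_law Leb Loss Reg c1 CR rho eta alpha lam fp fN X Y) q /\
    is_density Leb (output_law Leb Loss Reg c1 CR rho eta alpha lam fp fN X' Y') q' /\
    forall f : 'rV[R]_d, q f <= expR alpha * q' f.
Proof.
move=> hL _ B1 _ c10 CR0 rho0 eta0 alpha0 cL C2L L1 L2 C2Reg cReg vD vD' [k [_ kD]].
have [m0 a0 budget] := privacy_budget c1 CR rho eta alpha Bp Np B1 c10 CR0 rho0 eta0 alpha0.
set m := rho + _ + _ in m0 budget; set a := alpha_hat _ _ _ _ _ _ _ in a0 budget.
set c := CR / Bp%:R in budget.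
have c0 : 0 < c by rewrite divr_gt0// ltr0n.
pose J0 := base_objective Loss Reg c1 CR rho eta alpha lam fp fN k X Y.
have J0' : J0 = base_objective Loss Reg c1 CR rho eta alpha lam fp fN k X' Y'.
  exact: base_objective_ext.
have regJ0 : @regular_objective R d m J0 by exact: regular_base_objective.
pose l y (s : R) := Loss (y * s); pose dl y (s : R) := y * derive1 Loss (y * s).
have ldl y : y = 1 \/ y = -1 -> smooth_loss c1 (l y) (dl y) by exact: smooth_loss_label.
have [kY kY'] := ((vD k).2, (vD' k).2).
have null_preimage y (x : 'rV[R]_d) : y = 1 \/ y = -1 -> forall N, measurable N -> Leb N = 0%E ->
    Leb (perturbed_argmin (c := c) (add_loss (c := c) (l := l y) (J := J0) x) @^-1` N) = 0%E.
  move=> y1; have rJ := regular_add_loss c0 (ldl _ y1) regJ0 x.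
  apply: (lebesgue_rV_null_preimage _ hL); first exact: measurable_perturbed_argmin c0 m0 _ rJ.
  have [G SG] : exists G, smooth_with
      (smooth_part Loss c1 CR rho eta alpha lam fp fN k X Y) G by exact: smooth_partP.
  have SG' := smooth_withD _ _ _ _ SG (smooth_withZ c _ _ (smooth_with_loss (ldl _ y1) x (ltW c10))).
  apply: (perturbed_argmin_colipschitz c0 m0 (ltW rho0) C2Reg _ SG' _ rJ).
    exact: strongly_convex0_Reg.
  by apply/funext => f; rewrite /add_loss /J0 /base_objective -addrA.
pose F := perturbed_argmin (c := c) (add_loss (c := c) (l := l (Y k)) (J := J0) (X k)).
pose F' := perturbed_argmin (c := c) (add_loss (c := c) (l := l (Y' k)) (J := J0) (X' k)).
pose U := @add_loss_shift R d c (l (Y k)) (dl (Y k)) J0 (X k).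
pose U' := @remove_loss_shift R d c (dl (Y' k)) J0 (X' k).
(* Add the gradient of the old point to pass to the common objective, then subtract that of the new
   one. *)
have FE : F = F' \o (U' \o U).
  apply/funext => e; rewrite /F (perturbed_argmin_add c0 m0 (ldl _ kY) regJ0).
  by rewrite (perturbed_argmin_remove c0 m0 (ldl _ kY') regJ0 (X' k)).
have measurable_shift (g : 'rV[R]_d -> R) x : measurable_fun setT g ->
    measurable_fun setT (fun e : 'rV[R]_d => e + g e *: x).
  move=> mg; apply: measurable_fun_rVP => i.
  rewrite (_ : (fun _ => _) = (fun e : 'rV[R]_d => e ord0 i + g e * x ord0 i)); last first.
    by apply/funext => e; rewrite !mxE.
  by apply: measurable_funD; [exact: measurable_coord|exact: measurable_funM].
have mU : measurable_fun setT U.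
  apply: measurable_shift.
  exact: (measurable_add_loss_gradient c0 m0 (ltW c10) (ldl _ kY) regJ0 (X k)).
have mU' : measurable_fun setT U'.
  apply: measurable_shift.
  exact: (measurable_remove_loss_gradient c0 m0 (ltW c10) (ldl _ kY') regJ0 (X' k)).
have mV : measurable_fun setT (U' \o U) by exact: measurableT_comp mU' mU.
have mF : measurable_fun setT F.
  exact: (measurable_perturbed_argmin c0 m0 _ (regular_add_loss c0 (ldl _ kY) regJ0 (X k))).
have mF' : measurable_fun setT F'.
  exact: (measurable_perturbed_argmin c0 m0 _ (regular_add_loss c0 (ldl _ kY') regJ0 (X' k))).
have Vle e : enorm ((U' \o U) e) <= enorm e + 2.
  have h1 : enorm (U e) <= enorm e + 1.
    by apply: shift_le (vD k).1; exact: smooth_loss_le1 (ldl _ kY) _.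
  have h2 : enorm (U' (U e)) <= enorm (U e) + 1.
    by apply: shift_le (vD' k).1; rewrite normrN; exact: smooth_loss_le1 (ldl _ kY') _.
  by rewrite /=; lra.
have VK B : measurable B -> (Leb ((U' \o U) @^-1` B) <= (1 + c1 * c / m)%:E * Leb B)%E.
  move=> mB; have mU'B : measurable (U' @^-1` B).
    by rewrite -[X in measurable X]setTI; exact: mU'.
  have h1 := lebesgue_add_loss_shift c0 m0 (ltW c10) (ldl _ kY) regJ0 (X k) (vD k).1 hL _ mU'B.
  apply: (le_trans h1); apply: lee_wpmul2l.
    by rewrite lee_fin addr_ge0// mulr_ge0 ?invr_ge0 ?mulr_ge0// ltW.
  exact: (lebesgue_remove_loss_shift c0 m0 (ltW c10) (ldl _ kY') regJ0 (X' k) (vD' k).1 hL).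
have K0 : 0 <= 1 + c1 * c / m.
  by rewrite addr_ge0// mulr_ge0 ?invr_ge0 ?mulr_ge0// ltW.
have oE : output Loss Reg c1 CR rho eta alpha lam fp fN X Y = F by exact: outputE.
have oE' : output Loss Reg c1 CR rho eta alpha lam fp fN X' Y' = F'.
  by rewrite /F' J0'; exact: outputE.
have n0 := noise_density_ge0 Leb a; have mn := measurable_noise_density Leb a.
have nfin := integral_noise_density_lty Leb a.
have [q [q0 mq Fq]] := image_density Leb (lebesgue_rV_sf Leb hL) F _ mF mn n0 nfin
  (null_preimage _ _ kY).
have [q' [q'0 mq' Fq']] := image_density Leb (lebesgue_rV_sf Leb hL) F' _ mF' mn n0 nfin
  (null_preimage _ _ kY').
(* The truncated version of q turns the almost everywhere bound into one at every f. *)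
exists (fun f => Num.min (q f) (expR alpha * q' f)), q'; split; [|split].
- split; first by move=> f; rewrite le_min q0 mulr_ge0// expR_ge0.
  split; first by apply: measurable_minr => //; exact: measurable_funM.
  move=> A mA; rewrite /output_law oE -/a Fq//; apply/esym.
  apply: integral_min_density => // B mB.
  have := noise_law_le Leb a a0 _ F' _ B K0 mV mF' Vle VK mB.
  rewrite -FE Fq// Fq'// => /le_trans; apply.
  apply: lee_wpmul2r; last by rewrite lee_fin.
  by apply: integral_ge0 => f _; rewrite lee_fin.
- split => //; split => // A mA.
  by rewrite /output_law oE' -/a Fq'.
- by move=> f; rewrite ge_min lexx orbT.
Qed.
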